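(* Let $l,N\ge1$ and let $\mu=(\mu_1,\dots,\mu_l)\subset\lambda=(\lambda_1,\dots,\lambda_{l+N})$ be partitions. Then $$so_{\lambda/\mu}(x^{\pm})=\sum_{\mu=z_0\prec z_1\prec\dots\prec z_{2N}=\lambda}\ \prod_{i=1}^N x_i^{2|z_{2i-1}|-|z_{2i}|-|z_{2i-2}|},$$ where the sum is over all sequences $(z_0,z_1,\dots,z_{2N})$ with $z_0=\mu$, $z_{2N}=\lambda$, $z_k=(z_{k,1},\dots,z_{k,l+\lceil k/2\rceil})$ weakly decreasing with nonnegative entries, such that for $0\le k\le 2N-1$ $$z_{k+1,j}\le z_{k,j-1}\le z_{k+1,j-1}\qquad\text{for } 2\le j\le l+\lceil\tfrac{k+1}{2}\rceil,$$ and such that for $1\le i\le N$ one has $z_{2i-1,l+i}\in\frac12\mathbb Z$ with $0\le z_{2i-1,l+i}\le\min\{z_{2i,l+i},\,z_{2i-2,l+i-1}\}$, while all the other entries $z_{k,j}$ are integers.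
   Context: Partitions may have zero entries here. $\mu\subset\lambda$ means $\mu_i\le\lambda_i$ for all $i$; $|z|$ is the sum of the entries of $z$; $x^{\pm}=(x_1,x_1^{-1},\dots,x_N,x_N^{-1})$. The skew odd orthogonal character is $so_{\lambda/\mu}(x^{\pm})=\langle\mu^{so}|\Gamma_+(x^{\pm})|\lambda^{so}\rangle$, with the following definitions. Heisenberg algebra: generators $a_n$ ($n\in\mathbb Z\setminus\{0\}$) with $[a_m,a_n]=m\delta_{m,-n}$. The Fock space $\mathcal M$ is generated by the vacuum $|0\rangle$ with $a_n|0\rangle=0$ for $n>0$ (so $\mathcal M\cong\mathbb C[a_{-1},a_{-2},\dots]$), and $\langle 0|$ is the dual vacuum, a linear functional on $\mathcal M$ with $\langle 0|a_{-n}=0$ for $n>0$ and $\langle 0|1|0\rangle=1$. Vertex operators: $$U(z)=(1+z)\exp\Big(\sum_{n\ge1}\tfrac{a_{-n}}{n}z^n\Big)\exp\Big(-\sum_{n\ge1}\tfrac{a_n}{n}(z^n+z^{-n})\Big)=\sum_{n\in\mathbb Z}U_nz^{-n},$$ $$U^*(z)=(1-z)\exp\Big(-\sum_{n\ge1}\tfrac{a_{-n}}{n}z^n\Big)\exp\Big(\sum_{n\ge1}\tfrac{a_n}{n}(z^n+z^{-n})\Big)=\sum_{n\in\mathbb Z}U^*_nz^{n}.$$ For $\lambda=(\lambda_1,\dots,\lambda_k)$, $|\lambda^{so}\rangle=U_{-\lambda_1}\cdots U_{-\lambda_k}|0\rangle$ and $\langle\lambda^{so}|=\langle0|U^*_{-\lambda_k}\cdots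 U^*_{-\lambda_1}$ (the latter depends on the number $k$ of entries). Finally $\Gamma_+(z)=\exp\big(\sum_{n\ge1}\frac{a_n}{n}z^n\big)$ and $\Gamma_+(x^{\pm})=\prod_{i=1}^N\Gamma_+(x_i)\Gamma_+(x_i^{-1})$. *)

(* Defs.v *)
From HB Require Import structures.
From mathcomp Require Import all_boot all_order all_algebra finmap.
From mathcomp Require Import monalg.
From mathcomp Require Import boolp classical_sets functions cardinality fsbigop.

Set Implicit Arguments.
Unset Strict Implicit.
Unset Printing Implicit Defensive.
Import Order.TTheory GRing.Theory Num.Theory.
Local Open Scope ring_scope.

(* The variable of index i stands for a_{-(i+1)}. *)
Notation fock F := {malg F[{cmonom nat}]}.

HB.lock Definition pderiv (F : fieldType) (i : nat) (v : fock F) : fock F :=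
  \sum_(m <- msupp v) << v@_m *+ m i *g divcm m (ucm i) >>.

Section Fock.
Variable F : fieldType.
Local Notation M := {malg F[{cmonom nat}]}.

Definition vac : M := 1.
Definition covac (v : M) : F := v@_mone.

(* a_n: multiplication by the variable for n < 0, n times the partial
   derivative for n > 0.  There is no generator a_0; its value is junk. *)
Definition heis (n : int) (v : M) : M :=
  match n with
  | Posz 0 => 0
  | Posz i.+1 => i.+1%:R *: pderiv i v
  | Negz i => << ucm i >> * v
  end.

Lemma mcoeff_pderiv i (v : M) m :
  (pderiv i v)@_m = v@_(mmul m (ucm i)) *+ (m i).+1.
Proof.
rewrite unlock raddf_sum /=.
under eq_bigr do rewrite mcoeffU.
have E k : k \in msupp v -> k != mmul m (ucm i) ->
    (v@_k *+ k i) *+ (divcm k (ucm i) == m) = 0.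
  move=> _ km; case: (posnP (k i)) => [->|ki]; first by rewrite mulr0n mul0rn.
  case: eqP => [e|]; last by rewrite mulr0n.
  case/negP: km; apply/cmP => j; rewrite -e cmM divcmE cmU.
  by case: eqP => [<-|_]; rewrite ?subnK // subn0 addn0.
case: (boolP (mmul m (ucm i) \in msupp v)) => hm.
  rewrite (bigD1_seq (mmul m (ucm i))) ?fset_uniq //= big1_seq ?addr0.
    have -> : divcm (mmul m (ucm i)) (ucm i) = m.
      by apply/eqP/cmP => j; rewrite divcmE cmM addnK.
    by rewrite eqxx cmM cmUU addn1 mulr1n.
  by move=> k /andP[km kv]; apply: E.
rewrite (mcoeff_outdom hm) mul0rn big1_seq // => k /andP[_ kv].
by apply: E => //; apply: contraNneq hm => <-.
Qed.

Lemma mcoeff_mulU i (v : M) m :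
  (<< ucm i >> * v)@_m = if m i == 0%N then 0 else v@_(divcm m (ucm i)).
Proof.
rewrite mcoeffMl msuppU1 big_seq_fset1.
under eq_bigr => k _ do rewrite (mcoeffUU (ucm i) 1) mul1r.
case: eqP => [mi0|/eqP mi].
  rewrite big1_seq // => k _; case: eqP => [e|]; last by rewrite mulr0n.
  by move: mi0; rewrite -e cmM cmUU.
have dK : mmul (ucm i) (divcm m (ucm i)) = m.
  apply/eqP/cmP => j; rewrite cmM divcmE cmU.
  by case: eqP => [<-|_]; rewrite ?add0n ?subn0 // subnKC // lt0n.
have E k : mmul (ucm i) k = m -> k = divcm m (ucm i).
  by move=> <-; apply/eqP/cmP => j; rewrite divcmE cmM addKn.
case: (boolP (divcm m (ucm i) \in msupp v)) => hm.
  rewrite (bigD1_seq (divcm m (ucm i))) ?fset_uniq //= big1_seq ?addr0.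
    by rewrite dK eqxx mulr1n.
  move=> k /andP[km _]; case: eqP => [/E e|]; last by rewrite mulr0n.
  by rewrite e eqxx in km.
rewrite (mcoeff_outdom hm) big1_seq // => k /andP[_ kv].
by case: eqP => [/E e|]; rewrite ?mulr0n // -e kv in hm.
Qed.

Lemma heis_comm (m n : int) (v : M) : m != 0 -> n != 0 ->
  heis m (heis n v) - heis n (heis m v) =
  (if m == - n then m%:~R else 0) *: v.
Proof.
have dd i j (w : M) : pderiv i (pderiv j w) = pderiv j (pderiv i w).
  apply/malgP => k.
  rewrite !mcoeff_pderiv !cmM !cmU.
  have -> : mmul (mmul k (ucm j)) (ucm i) = mmul (mmul k (ucm i)) (ucm j).
    by apply/eqP/cmP => l; rewrite !cmM addnAC.
  rewrite -!mulrnA; congr (_ *+ _).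
  by case: (eqVneq i j) => [->|_]; rewrite ?eqxx // !addn0 mulnC.
have dm i j (w : M) : pderiv i (<< ucm j >> * w) - << ucm j >> * pderiv i w
              = (i == j)%:R *: w.
  apply/malgP => k; rewrite mcoeffB mcoeffZ mcoeff_pderiv !mcoeff_mulU.
  rewrite cmM cmU mcoeff_pderiv divcmE cmU [j == i]eq_sym.
  have [<-|ij] := eqVneq i j.
    rewrite addn1 /= mul1r.
    have -> : divcm (mmul k (ucm i)) (ucm i) = k.
      by apply/eqP/cmP => l; rewrite divcmE cmM addnK.
    case: (posnP (k i)) => [->|ki]; first by rewrite mulr1n subr0.
    rewrite subn1 prednK //.
    have -> : mmul (divcm k (ucm i)) (ucm i) = k.
      apply/eqP/cmP => l; rewrite cmM divcmE cmU.
      by case: eqP => [<-|_]; rewrite ?subnK // subn0 addn0.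
    by rewrite mulrSr addrAC subrr add0r.
  rewrite addn0 subn0 /= mul0r.
  case: eqP => [_|/eqP kj]; first by rewrite mul0rn subrr.
  suff -> : divcm (mmul k (ucm i)) (ucm j) = mmul (divcm k (ucm j)) (ucm i).
    by rewrite subrr.
  apply/eqP/cmP => l; rewrite cmM !divcmE cmM !cmU.
  have [<-|] := eqVneq j l; last by rewrite !subn0.
  by rewrite (negPf ij) !addn0.
have pZ i (c : F) (w : M) : pderiv i (c *: w) = c *: pderiv i w.
  by apply/malgP => k; rewrite mcoeffZ !mcoeff_pderiv mcoeffZ mulrnAr.
have sC (a b : F) (w : M) : a *: (b *: w) = b *: (a *: w).
  by rewrite !scalerA mulrC.
case: m n => [[|m]|m] [[|n]|n] // _ _ /=.
- by rewrite !pZ dd sC subrr scale0r.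
- by rewrite -scalerAr -scalerBr dm scalerA eqz_nat eqSS; case: eqP => _;
    rewrite ?mulr1 ?mulr0.
- rewrite -scalerAr -scalerBr -opprB dm !NegzE eqr_opp eqz_nat eqSS [n == m]eq_sym.
  case: eqP => [->|_]; last by rewrite !scale0r oppr0 scaler0.
  by rewrite scale1r scalerN -scaleNr mulrNz.
- have E (a b w : M) : a * (b * w) - b * (a * w) = 0.
    by rewrite mulrCA subrr.
  by rewrite E scale0r.
Qed.

Lemma heis_vac (n : int) : 0 < n -> heis n vac = 0.
Proof.
case: n => [[|n]|n] // _; rewrite /= /vac; apply/malgP => k.
rewrite mcoeffZ mcoeff_pderiv mcoeff1 mcoeff0 cmM_eq1 cm1_eq1 andbF.
by rewrite mul0rn mulr0.
Qed.

Lemma covac_heisN (n : int) (v : M) : n < 0 -> covac (heis n v) = 0.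
Proof. by case: n => // n _; rewrite /covac /= mcoeff_mulU cm1. Qed.

Lemma covac_vac : covac vac = 1.
Proof. by rewrite /covac mcoeff1 eqxx. Qed.

End Fock.

Section VertexOperators.
Variable F : fieldType.
Local Notation M := (fock F).
Local Open Scope classical_set_scope.

(* Formal series \sum_(j : int) A_j z^j whose coefficients are operators on
   the Fock space.  The sums below are infinite, but on a given vector only
   finitely many terms are nonzero: a_n kills every polynomial of weight < n,
   where the variable a_{-n} has weight n. *)
Definition opser := int -> M -> M.

Definition opscale (c : F) (A : opser) : opser := fun j v => c *: A j v.

Definition opmul (A B : opser) : opser :=
  fun j v => \sum_(i \in [set: int]) A i (B (j - i) v).

Definition opone : opser := fun j v => if j == 0 then v else 0.

Definition opexp (A : opser) : opser := fun j v =>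
  \sum_(k \in [set: nat]) (k`!%:R)^-1 *: iter k (opmul A) opone j v.

(* 1 + s z *)
Definition binomial_ser (s : F) : opser := fun j v =>
  if j == 0 then v else if j == 1 then s *: v else 0.

(* \sum_(n >= 1) (a_{-n} / n) z^n *)
Definition creation_ser : opser := fun j v =>
  if 0 < j then (j%:~R)^-1 *: heis (- j) v else 0.

(* \sum_(n >= 1) (a_n / n) (z^n + z^{-n}) *)
Definition annihilation_ser : opser := fun j v =>
  if j == 0 then 0 else (`|j|%:~R)^-1 *: heis `|j| v.

Definition U_ser : opser :=
  opmul (opmul (binomial_ser 1) (opexp creation_ser))
        (opexp (opscale (-1) annihilation_ser)).

Definition Ustar_ser : opser :=
  opmul (opmul (binomial_ser (-1)) (opexp (opscale (-1) creation_ser)))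
        (opexp annihilation_ser).

(* U(z) is expanded in z^{-n} but U^*(z) in z^n. *)
Definition U (n : int) : M -> M := U_ser (- n).
Definition Ustar (n : int) : M -> M := Ustar_ser n.

Definition ket (lambda : seq nat) : M :=
  foldr (fun p v => U (- (Posz p)) v) (vac F) lambda.

(* <0| U^*_{-lambda_k} ... U^*_{-lambda_1} : the operator of index
   -lambda_1 acts first. *)
Definition bra (lambda : seq nat) (v : M) : F :=
  covac (foldl (fun w p => Ustar (- (Posz p)) w) v lambda).

Definition Gamma_exponent (x : F) (v : M) : M :=
  \sum_(n \in [set n : nat | (0 < n)%N]) (x ^+ n / n%:R) *: heis n v.

Definition Gamma (x : F) (v : M) : M :=
  \sum_(k \in [set: nat]) (k`!%:R)^-1 *: iter k (Gamma_exponent x) v.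

Definition Gamma_pm (N : nat) (x : 'I_N -> F) (v : M) : M :=
  foldr (fun i w => Gamma (x i) (Gamma (x i)^-1 w)) v (enum 'I_N).

Definition skew_so (N : nat) (mu lambda : seq nat) (x : 'I_N -> F) : F :=
  bra mu (Gamma_pm x (ket lambda)).

End VertexOperators.

Section Patterns.
Implicit Type z : seq (seq rat).

Definition zrow z (k : nat) : seq rat := nth [::] z k.

(* Rows are numbered from 0 and positions in a row from 1. *)
Definition zent z (k j : nat) : rat := nth 0 (zrow z k) j.-1.

Definition zsum z (k : nat) : rat := \sum_(t <- zrow z k) t.

(* uphalf k is the ceiling of k / 2. *)
Record so_pattern (l N : nat) (mu lambda : seq nat) z : Prop := SoPattern {
  pat_size : size z = N.*2.+1;
  pat_row_size : forall k, (k <= N.*2)%N -> size (zrow z k) = (l + uphalf k)%N;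
  pat_first : zrow z 0 = [seq p%:R | p <- mu];
  pat_last : zrow z N.*2 = [seq p%:R | p <- lambda];
  pat_sorted : forall k, (k <= N.*2)%N -> sorted >=%R (zrow z k);
  pat_ge0 : forall k, (k <= N.*2)%N -> {in zrow z k, forall t, 0 <= t};
  pat_interlace : forall k j, (k < N.*2)%N -> (2 <= j <= l + uphalf k.+1)%N ->
    zent z k.+1 j <= zent z k j.-1 <= zent z k.+1 j.-1;
  pat_half : forall i, (1 <= i <= N)%N ->
    [/\ 2 * zent z i.*2.-1 (l + i) \is a Num.int,
        0 <= zent z i.*2.-1 (l + i)
      & zent z i.*2.-1 (l + i)
          <= Num.min (zent z i.*2 (l + i)) (zent z i.*2.-2 (l + i).-1)];
  pat_int : forall k j, (k <= N.*2)%N -> (1 <= j <= l + uphalf k)%N ->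
    ~ (exists i, [/\ (1 <= i <= N)%N, k = i.*2.-1 & j = (l + i)%N]) ->
    zent z k j \is a Num.int
}.

(* The exponent of x_{i+1}, for 0 <= i < N; by zexp_int below, taking the
   floor only casts an integer from rat to int. *)
Definition zexp_rat z (i : nat) : rat :=
  2 * zsum z i.*2.+1 - zsum z i.*2.+2 - zsum z i.*2.
Definition zexp z (i : nat) : int := Num.floor (zexp_rat z i).

Lemma zexp_int (l N : nat) (mu lambda : seq nat) z (i : nat) :
  so_pattern l N mu lambda z -> (i < N)%N -> (zexp z i)%:~R = zexp_rat z i.
Proof.
move=> pz iN; apply/floorK.
have even k : (k <= N)%N -> zsum z k.*2 \is a Num.int.
  move=> kN; have k2N : (k.*2 <= N.*2)%N by rewrite leq_double.
  rewrite /zsum (big_nth 0) big_mkord rpred_sum // => j _.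
  apply: (pat_int (j := j.+1) pz k2N); first by rewrite -(pat_row_size pz k2N) ltn_ord.
  case=> -[|m] [] // _ /(congr1 odd).
  by rewrite doubleS /= !odd_double.
have odd_row : 2 * zsum z i.*2.+1 \is a Num.int.
  have k2N : (i.*2.+1 <= N.*2)%N by rewrite ltn_double.
  rewrite /zsum (big_nth 0) big_mkord mulr_sumr rpred_sum // => j _.
  have ji : (1 <= j.+1 <= l + uphalf i.*2.+1)%N.
    by rewrite -(pat_row_size pz k2N) ltn_ord.
  case: (eqVneq j.+1 (l + i.+1)%N) => [e|ne].
    by have [] := pat_half pz (i := i.+1) iN; rewrite doubleS -e.
  apply: rpredM; first exact: rpred_nat.
  apply: (pat_int (j := j.+1) pz k2N ji) => -[[|m] []] // _.
  rewrite doubleS /= => -[/double_inj <-] e.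
  by rewrite e eqxx in ne.
by rewrite /zexp_rat !rpredB // -?doubleS even // ltnW.
Qed.

End Patterns.

(* Main.v *)
Require Import Defs.
From HB Require Import structures.
From mathcomp Require Import all_boot all_order all_algebra finmap.
From mathcomp Require Import monalg.
From mathcomp Require Import boolp classical_sets functions cardinality fsbigop.
From mathcomp Require Import zify ring lra.

Set Implicit Arguments.
Unset Strict Implicit.
Unset Printing Implicit Defensive.
Import Order.TTheory GRing.Theory Num.Theory.
Local Open Scope classical_set_scope.
Local Open Scope ring_scope.

(** Multiplication by the creation operators and the commutation rules of the Heisenberg algebra
    determine U_p and U^*_q up to vacuum expectations, so every quadratic relation between them is
    obtained by computing those expectations on the vacuum.  This gives the antisymmetry
    U^*_{-p-1} U^*_{-q} = - U^*_{-q-1} U^*_{-p}, the relation U_{-p} U^*_{-q} + U^*_{-q+1} U_{-p+1}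
    = delta_{p,q}, whence <mu|nu> = delta for partitions with the same number of entries, and
    U^*_{-q} Gamma(y) = sum_(a >= q) y^(a-q) Gamma(y) U^*_{-a}.

    Moving Gamma(y) to the left through <mu| therefore gives the sum over all nu >= mu
    (componentwise) of y^(|nu|-|mu|) <nu|, with <0| replaced by <0| Gamma(y); the antisymmetry
    cancels every term in which nu/mu is not a horizontal strip.  Finally <0| Gamma(y) is a
    combination of the <0| Gamma(1/y)^-1 U^*_{-k}, k >= 0, with coefficients y^k + y^(k-1) (1 for
    k = 0): this creates the additional entry of the odd row, the two terms being its values k and
    k - 1/2.  Moving Gamma(1/y) through the l + 1 operators yields the even row, so that
    Gamma(y) Gamma(1/y) accounts for two rows of the pattern. *)

(** * Finitely supported sums *)

(** The obstacle is the left end: <0| is not an eigenvector of Gamma(y), so Gamma(y) cannot be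
    absorbed after passing the operators of <mu|. The way out is that <0| Gamma(y) Gamma(1/y) and
    all <0| U^*_{-q} are combinations of the same functionals c_j = c_{-j}, the coefficients of z^j
    in <0| Gamma(z) Gamma(1/z): they are the sum of the y^j c_j and c_q - c_{q+1}, respectively.
    Summation by parts gives the coefficients o_q = y^-q + ... + y^q. Conjugating U^*_{-k} by
    Gamma(1/y) spreads it over all q >= k with factors y^(k-q), and undoing this turns o_k into o_k
    - o_{k-1}/y = y^k + y^(k-1).

    The expectations are coefficients of explicit rational functions in z and w. They are verified
    by a recursion on the index of the inner operator, obtained from z d/dz of its series on the
    vacuum; each step divides by that index, hence characteristic zero.

    All sums over q or nu are formally infinite. As U^*_{-q} kills vectors of weight below q, they
    are cut at any B above the weight of the vector at hand, and B stays free until the comparison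
    with patterns. *)

Section FiniteSupport.
Variables (T : choiceType) (V : zmodType).
Implicit Types (f g : T -> V).

(** The sum over [[set: T]] of a family with infinite support is 0 by convention, so it is additive
    only under a hypothesis of this kind. *)
Definition fsupp f := exists A : {fset T}, forall i, i \notin A -> f i = 0.

Lemma fsuppD f g : fsupp f -> fsupp g -> fsupp (fun i => f i + g i).
Proof.
move=> [A fA] [B gB]; exists (A `|` B)%fset => i.
by rewrite in_fsetU negb_or => /andP[/fA-> /gB->]; rewrite addr0.
Qed.

Lemma fsum_split f g : fsupp f -> fsupp g ->
  \sum_(i \in [set: T]) (f i + g i) =
  \sum_(i \in [set: T]) f i + \sum_(i \in [set: T]) g i.
Proof.
move=> [A fA] [B gB].
have fAB i : i \notin (A `|` B)%fset -> f i = 0.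
  by rewrite in_fsetU negb_or => /andP[/fA].
have gAB i : i \notin (A `|` B)%fset -> g i = 0.
  by rewrite in_fsetU negb_or => /andP[_ /gB].
rewrite (fsbigTE (A `|` B)%fset); last by move=> i iAB; rewrite fAB ?gAB ?addr0.
by rewrite big_split /= -(fsbigTE _ _ fAB) -(fsbigTE _ _ gAB).
Qed.

Lemma fsum_morph (W : zmodType) (phi : V -> W) f :
  phi 0 = 0 -> (forall u v, phi (u + v) = phi u + phi v) -> fsupp f ->
  phi (\sum_(i \in [set: T]) f i) = \sum_(i \in [set: T]) phi (f i).
Proof.
move=> phi0 phiD [A fA]; rewrite (fsbigTE A) //.
rewrite (fsbigTE A); last by move=> i /fA->.
exact: (big_morph phi).
Qed.

End FiniteSupport.

Lemma fsupp_sub (T : choiceType) (V W : zmodType) (f : T -> V) (g : T -> W) :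
  fsupp f -> (forall i, f i = 0 -> g i = 0) -> fsupp g.
Proof. by move=> [A fA] fg; exists A => i /fA/fg. Qed.

Lemma fsum_shift (V : zmodType) (f : int -> V) (n : int) :
  \sum_(i \in [set: int]) f (i - n) = \sum_(i \in [set: int]) f i.
Proof.
apply/esym; apply: (reindex_fsbigT (fun i => i - n)).
by exists (fun i => i + n) => i; rewrite ?subrK ?addrK.
Qed.

Lemma fsupp_shift (V : zmodType) (f : int -> V) (n : int) :
  fsupp f -> fsupp (fun i => f (i - n)).
Proof.
move=> [A fA]; exists [fset (i + n)%R | i in A]%fset => i iA; apply: fA.
by apply: contra iA => iA; apply/imfsetP; exists (i - n) => //; rewrite subrK.
Qed.

Lemma fsum_nat (V : zmodType) (f : nat -> V) n : (forall i, (n <= i)%N -> f i = 0) ->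
  \sum_(i \in [set: nat]) f i = \sum_(i < n) f i.
Proof.
move=> fn; rewrite fsbig_ord; apply/esym/fsbig_widen => // i [_ /= /negP].
by rewrite -leqNgt => /fn.
Qed.

Lemma linZD (F : fieldType) (V W : lmodType F) (f : V -> W) : linear f ->
  [/\ f 0 = 0, forall u v, f (u + v) = f u + f v & forall a v, f (a *: v) = a *: f v].
Proof.
move=> lf; have fD u v : f (u + v) = f u + f v by rewrite -[u]scale1r lf !scale1r.
have f0 : f 0 = 0 by apply: (addrI (f 0)); rewrite -fD !addr0.
by split=> // a v; rewrite -[in LHS](addr0 (a *: v)) lf f0 addr0.
Qed.

Lemma lin0 (F : fieldType) (V W : lmodType F) (f : V -> W) : linear f -> f 0 = 0.
Proof. by case/linZD. Qed.

Lemma linD (F : fieldType) (V W : lmodType F) (f : V -> W) : linear f ->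
  forall u v, f (u + v) = f u + f v.
Proof. by case/linZD. Qed.

Lemma linZ (F : fieldType) (V W : lmodType F) (f : V -> W) : linear f ->
  forall a v, f (a *: v) = a *: f v.
Proof. by case/linZD. Qed.

Lemma linN (F : fieldType) (V W : lmodType F) (f : V -> W) : linear f ->
  forall v, f (- v) = - f v.
Proof. by move=> lf v; rewrite -scaleN1r linZ // scaleN1r. Qed.

Lemma lin_sum (F : fieldType) (V W : lmodType F) (f : V -> W) : linear f ->
  forall (I : Type) (r : seq I) (P : pred I) (E : I -> V),
  f (\sum_(i <- r | P i) E i) = \sum_(i <- r | P i) f (E i).
Proof. by move=> /linZD[f0 fD _] I r P E; apply: (big_morph f). Qed.

Lemma linear_fsum (F : fieldType) (V W : lmodType F) (T : choiceType) (f : T -> V -> W) :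
  (forall i, linear (f i)) -> (forall v, fsupp (f^~ v)) ->
  linear (fun v => \sum_(i \in [set: T]) f i v).
Proof.
move=> lf sf a u v; rewrite (fsum_morph (phi := fun w => a *: w)) ?scaler0 //; last exact: scalerDr.
rewrite -fsum_split //; last first.
  by apply: fsupp_sub (sf u) _ => i ->; rewrite scaler0.
by apply: eq_fsbigr => i _; apply: lf.
Qed.

Lemma lin_add (F : fieldType) (V W : lmodType F) (f g : V -> W) :
  linear f -> linear g -> linear (fun v => f v + g v).
Proof. by move=> lf lg a u v; rewrite lf lg scalerDr addrACA. Qed.

Lemma lin_scale (F : fieldType) (V W : lmodType F) (c : F) (f : V -> W) :
  linear f -> linear (fun v => c *: f v).
Proof. by move=> lf a u v; rewrite lf scalerDr !scalerA mulrC. Qed.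

Lemma lin_opp (F : fieldType) (V W : lmodType F) (f : V -> W) :
  linear f -> linear (fun v => - f v).
Proof. by move=> lf a u v; rewrite lf opprD scalerN. Qed.

Lemma lin_comp (F : fieldType) (U V W : lmodType F) (f : V -> W) (g : U -> V) :
  linear f -> linear g -> linear (fun v => f (g v)).
Proof. by move=> lf lg a u v; rewrite lg lf. Qed.

Lemma lin_id (F : fieldType) (V : lmodType F) : linear (fun v : V => v).
Proof. by []. Qed.

(** * Fock representations *)

(* Only these properties of the Fock space are used; the record keeps its multiplication opaque.
   [raise i] is multiplication by a_{-(i+1)} and [lower i] is d/da_{-(i+1)}. *)
Record fock_rep (F : fieldType) := FockRep {
  fsort :> lmodType F;
  raise : nat -> fsort -> fsort;
  lower : nat -> fsort -> fsort;
  vacuum : fsort;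
  vev : fsort -> F;
  raise_linear : forall i, linear (raise i);
  lower_linear : forall i, linear (lower i);
  vev_linear : linear (vev : fsort -> F^o);
  raiseC : forall i j v, raise i (raise j v) = raise j (raise i v);
  lowerC : forall i j v, lower i (lower j v) = lower j (lower i v);
  lower_raise : forall i j v, lower i (raise j v) = raise j (lower i v) + (i == j)%:R *: v;
  lower_vacuum : forall i, lower i vacuum = 0;
  vev_raise : forall i v, vev (raise i v) = 0;
  vev_vacuum : vev vacuum = 1;
  fock_ind : forall P : fsort -> Prop, P vacuum -> (forall i v, P v -> P (raise i v)) ->
    (forall a u v, P u -> P v -> P (a *: u + v)) -> forall v, P v;
  fock_family_eq0 : forall (I : Type) (D : I -> fsort),
    (forall a, vev (D a) = 0) ->
    (forall i a, exists c1 a1 c2 a2, lower i (D a) = c1 *: D a1 + c2 *: D a2) ->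
    forall a, D a = 0
}.

(** * The polynomial Fock space as a representation *)

Section Fock.
Variable F : fieldType.
Hypothesis pchar0 : [pchar F] =i pred0.
Local Notation M := (fock F).
Local Notation "''v_' i" := (<< ucm i >> : M) (at level 8, i at level 2, format "''v_' i").

Lemma natrS_neq0 n : n.+1%:R != 0 :> F.
Proof. by move/pcharf0P: pchar0 => ->. Qed.

Lemma mulrSn_eq0 (c : F) n : (c *+ n.+1 == 0) = (c == 0).
Proof. by rewrite -mulr_natr mulf_eq0 (negPf (natrS_neq0 n)) orbF. Qed.

Lemma malgUZ (a : F) (m : {cmonom nat}) : << a *g m >> = a *: << m >> :> M.
Proof.
by apply/malgP => k; rewrite mcoeffU mcoeffZ mcoeffU mulr_natr.
Qed.

Lemma mdegS_split (m : {cmonom nat}) n : mdeg m = n.+1 ->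
  exists i m', m = mmul (ucm i) m' /\ mdeg m' = n.
Proof.
move=> mn; have [i mi] : exists i, i \in finsupp m.
  apply/fset0Pn; apply: contra_eqN mn => /eqP fm0.
  by rewrite mdegE fm0 big_seq_fset0.
have mE : m = mmul (ucm i) (divcm m (ucm i)).
  apply/eqP/cmP => j; rewrite cmM divcmE cmU.
  case: eqP => [<-|_]; last by rewrite subn0.
  by rewrite subnKC // lt0n cmE_neq0.
exists i, (divcm m (ucm i)); split=> //.
by move: mn; rewrite mE mdegM mdegU -mE => -[].
Qed.

Lemma malg_ind (P : M -> Prop) : P 1 -> (forall i v, P v -> P ('v_i * v)) ->
  (forall a u v, P u -> P v -> P (a *: u + v)) -> forall v, P v.
Proof.
move=> P1 PX PL.
have P0 : P 0 by rewrite -(addNr 1) -scaleN1r; apply: PL.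
have Pm n : forall m : {cmonom nat}, mdeg m = n -> P << m >>.
  elim: n => [m /mdeg_eq0I-> //|n IH m /mdegS_split[i [m' [-> m'n]]]].
  have -> : << mmul (ucm i) m' >> = 'v_i * << m' >> by rewrite malgM_def fgmulUU mulr1.
  by apply: PX; apply: IH.
move=> v; rewrite (monalgE v); elim: (enum_fset _) => [|m s IH]; rewrite ?big_nil // big_cons.
rewrite malgUZ.
apply: PL.
  exact: (Pm _ _ erefl).
exact: IH.
Qed.

Lemma pderiv_linear i : linear (@pderiv F i).
Proof.
by move=> a u v; apply/malgP => m; rewrite !(mcoeff_pderiv, mcoeffD, mcoeffZ) mulrnDl mulrnAr.
Qed.

(** [heis_comm] gives the relation up to the factor (i+1)(j+1), which can be cancelled in
    characteristic zero. *)
Lemma pderivC i j (v : M) : pderiv i (pderiv j v) = pderiv j (pderiv i v).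
Proof.
have heisC : heis i.+1 (heis j.+1 v) = heis j.+1 (heis i.+1 v).
  by apply/eqP; rewrite -subr_eq0 heis_comm // scale0r.
have := heisC; rewrite /= !(linZ (@pderiv_linear _)) !scalerA mulrC => /scalerI; apply.
by rewrite mulf_neq0 ?natrS_neq0.
Qed.

Lemma pderivX i j (v : M) : pderiv i ('v_j * v) = 'v_j * pderiv i v + (i == j)%:R *: v.
Proof.
apply: (scalerI (natrS_neq0 i)); apply/eqP; rewrite scalerDr addrC -subr_eq; apply/eqP.
have := @heis_comm F i.+1 (Negz j) v isT isT.
rewrite /= NegzE opprK eqz_nat eqSS -scalerAr => ->.
by case: eqP => _; [rewrite scale1r | rewrite !scale0r scaler0].
Qed.

Lemma pderiv1 i : pderiv i (1 : M) = 0.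
Proof. by apply: (scalerI (natrS_neq0 i)); rewrite scaler0 -(heis_vac F (n := i.+1)). Qed.

Lemma covac_linear : linear (@covac F : M -> F^o).
Proof. by move=> a u v; rewrite /covac mcoeffD mcoeffZ. Qed.

Lemma covacX i (v : M) : covac ('v_i * v) = 0.
Proof. exact: (@covac_heisN F (Negz i)). Qed.

Lemma covac1 : covac (1 : M) = 1.
Proof. exact: covac_vac. Qed.

(* Coefficients are read off from the constant terms of iterated derivatives. *)
Lemma family_eq0 (I : Type) (D : I -> M) :
  (forall a, covac (D a) = 0) ->
  (forall i a, exists c1 a1 c2 a2, pderiv i (D a) = c1 *: D a1 + c2 *: D a2) ->
  forall a, D a = 0.
Proof.
move=> D0 DD; suff H n : forall (m : {cmonom nat}) a, mdeg m = n -> (D a)@_m = 0.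
  by move=> a; apply/malgP => m; rewrite mcoeff0; apply: H erefl.
elim: n => [m a /mdeg_eq0I->|n IH m a /mdegS_split[i [m' [-> m'n]]]]; first exact: D0.
have [c1 [a1 [c2 [a2 /(congr1 (mcoeff m'))]]]] := DD i a.
rewrite mcoeff_pderiv mcoeffD.
have Z c b : (c *: D b)@_m' = 0 by rewrite mcoeffZ (IH _ _ m'n) mulr0.
rewrite [X in _ = X + _]Z [X in _ = _ + X]Z addr0 [mmul _ _]mulmC => /eqP.
by rewrite mulrSn_eq0 => /eqP.
Qed.

Lemma mulvar_linear i : linear (fun v : M => 'v_i * v).
Proof. by move=> a u v; rewrite mulrDr scalerAr. Qed.

Lemma mulvarC i j (v : M) : 'v_i * ('v_j * v) = 'v_j * ('v_i * v).
Proof. exact: mulrCA. Qed.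

Definition malg_fock_rep : fock_rep F :=
  @FockRep F M (fun i v => 'v_i * v) (@pderiv F) 1 (@covac F) mulvar_linear pderiv_linear
    covac_linear mulvarC pderivC pderivX pderiv1 covacX covac1 malg_ind family_eq0.

End Fock.

Lemma fsupp_int (V : zmodType) (f : int -> V) (B : nat) :
  (forall i, (B < `|i|)%N -> f i = 0) -> fsupp f.
Proof.
move=> fB; pose s := [seq Posz i - Posz B | i <- iota 0 B.*2.+1].
exists [fset x in s]%fset => i; rewrite in_fset => /negP iB.
apply: fB; rewrite ltnNge; apply/negP => le_iB.
apply: iB; apply/mapP; exists (absz ((i : int) + Posz B)); first by rewrite mem_iota; lia.
by lia.
Qed.

Lemma fsum_int1 (V : zmodType) (f : int -> V) (n : int) :
  (forall i, i != n -> f i = 0) -> \sum_(i \in [set: int]) f i = f n.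
Proof.
move=> fn; rewrite -(fsbig_set1 +%R n f); apply/esym/fsbig_widen => // i [_ /= /eqP].
exact: fn.
Qed.

Lemma fsum_lin (F : fieldType) (T : choiceType) (V W : lmodType F) (phi : V -> W) (f : T -> V) :
  linear phi -> fsupp f -> phi (\sum_(i \in [set: T]) f i) = \sum_(i \in [set: T]) phi (f i).
Proof. by case/linZD => phi0 phiD _; apply: fsum_morph. Qed.

Lemma fsumZ (F : fieldType) (T : choiceType) (V : lmodType F) (a : F) (f : T -> V) : fsupp f ->
  a *: (\sum_(i \in [set: T]) f i) = \sum_(i \in [set: T]) a *: f i.
Proof. by apply: fsum_morph; [rewrite scaler0 | apply: scalerDr]. Qed.

(** * Vertex operators *)

Section RepSeries.
Variables (F : fieldType) (R : fock_rep F).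
Local Notation M := (fsort R).

(** Since a_{i+1} acts as i+1 times [lower i], the choice t i = y^(i+1) gives the exponent of
    Gamma(y). The exponential is the translation of each variable a_{-(i+1)} by t i; a general [t]
    also covers its inverse, the translation by -t. *)
Definition shift_exponent (t : nat -> F) (v : M) : M :=
  \sum_(i \in [set: nat]) t i *: lower i v.

Definition shift_exp (t : nat -> F) (v : M) : M :=
  \sum_(k \in [set: nat]) (k`!%:R)^-1 *: iter k (shift_exponent t) v.

Definition ropser := int -> M -> M.

Definition ropmul (A B : ropser) : ropser :=
  fun j v => \sum_(i \in [set: int]) A i (B (j - i) v).

Definition ropone : ropser := fun j v => if j == 0 then v else 0.

Definition opiter (A : ropser) (k : nat) : ropser := iter k (ropmul A) ropone.

Definition ropexp (A : ropser) : ropser := fun j v =>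
  \sum_(k \in [set: nat]) (k`!%:R)^-1 *: opiter A k j v.

Definition rbinomial (s : F) : ropser := fun j v =>
  if j == 0 then v else if j == 1 then s *: v else 0.

Definition rcreation (c : F) : ropser := fun j v =>
  if 0 < j then c *: ((j%:~R)^-1 *: raise `|j|.-1 v) else 0.

(** a_n / n is the derivative [lower n.-1], hence no denominator; the exponents n and -n carry the
    same operator. *)
Definition rannihilation (c : F) : ropser := fun j v =>
  if j == 0 then 0 else c *: lower `|j|.-1 v.

(* U(z) is the case s = c = 1, and U^*(z) the case s = c = -1. *)
Definition vertex (s c : F) : ropser :=
  ropmul (ropmul (rbinomial s) (ropexp (rcreation c))) (ropexp (rannihilation (- c))).

End RepSeries.

Section Exponentials.
Variable F : fieldType.
Hypothesis pchar0 : [pchar F] =i pred0.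
Variable R : fock_rep F.
Local Notation M := (fsort R).

Implicit Types u v w : M.

Definition vars_below B (v : M) := forall i, (B <= i)%N -> lower i v = 0.

Lemma exists_vars_below v : exists B, vars_below B v.
Proof.
elim/fock_ind: v => [|i v [B vB]|a u v [B uB] [C vC]].
- by exists 0%N => i _; rewrite lower_vacuum.
- exists (maxn B i.+1) => j; rewrite geq_max => /andP[/vB vj ij].
  by rewrite lower_raise vj (lin0 (raise_linear i)) gtn_eqF // scale0r addr0.
- exists (maxn B C) => j; rewrite geq_max => /andP[/uB uj /vC vj].
  by rewrite lower_linear uj vj scaler0 addr0.
Qed.

(** Polynomial degree below K, phrased through iterated derivatives: it makes the powers of an
    exponent built from derivatives vanish from the K-th on. *)
Fixpoint deg_below K (v : M) : Prop :=
  if K is K'.+1 then forall i, deg_below K' (lower i v) else v = 0.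

Lemma deg_belowS K v : deg_below K v -> deg_below K.+1 v.
Proof.
elim: K v => [v /= -> i|K IH v vK i]; first exact: lin0 (lower_linear i).
exact/IH/vK.
Qed.

Lemma deg_belowW K L v : (K <= L)%N -> deg_below K v -> deg_below L v.
Proof.
move=> /subnK<-; elim: (L - K)%N => // n IH /IH; rewrite addSn; exact: deg_belowS.
Qed.

Lemma deg_belowD K a u v : deg_below K u -> deg_below K v -> deg_below K (a *: u + v).
Proof.
elim: K u v => [u v /= -> ->|K IH u v uK vK i]; first by rewrite scaler0 addr0.
by rewrite lower_linear; apply: IH.
Qed.

Lemma deg_below_raise K i v : deg_below K v -> deg_below K.+1 (raise i v).
Proof.
elim: K v => [v /= -> j|K IH v vK j].
  by rewrite (lin0 (raise_linear i)) (lin0 (lower_linear j)).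
rewrite lower_raise addrC; apply: (@deg_belowD K.+1); [exact: vK | exact/IH/vK].
Qed.

Lemma exists_deg_below v : exists K, deg_below K v.
Proof.
elim/fock_ind: v => [|i v [K vK]|a u v [K uK] [L vL]].
- by exists 1%N => i; rewrite lower_vacuum.
- by exists K.+1; apply: deg_below_raise.
- exists (maxn K L); apply: deg_belowD.
    exact: deg_belowW (leq_maxl _ _) uK.
  exact: deg_belowW (leq_maxr _ _) vL.
Qed.

Lemma invr_factS n : (n.+1`!%:R)^-1 * n.+1%:R = (n`!%:R)^-1 :> F.
Proof. by rewrite factS natrM invfM mulrAC mulVf ?mul1r // natrS_neq0. Qed.

(** How a commutator passes to an exponential: [a], [b], [c] stand for D^k X v, X D^k v and [D, X]
    D^k v, or the same with the orders exchanged, and the factor k + 1 is absorbed by the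
    factorial. *)
Lemma fsum_exp (V : lmodType F) (a b c : nat -> V) K :
  (forall k, (K <= k)%N -> b k = 0) -> (forall k, (K <= k)%N -> c k = 0) ->
  a 0%N = b 0%N -> (forall k, a k.+1 = b k.+1 + k.+1%:R *: c k) ->
  \sum_(k \in [set: nat]) (k`!%:R)^-1 *: a k =
  \sum_(k \in [set: nat]) (k`!%:R)^-1 *: b k + \sum_(k \in [set: nat]) (k`!%:R)^-1 *: c k.
Proof.
move=> bK cK a0 aS.
rewrite (fsum_nat (n := K.+1)); last first.
  by case=> [|k] kK; [rewrite ltn0 in kK | rewrite aS bK ?cK ?scaler0 ?addr0 ?scaler0 // ltnW].
rewrite (fsum_nat (n := K.+1)); last by move=> k /ltnW /bK->; rewrite scaler0.
rewrite (fsum_nat (n := K)); last by move=> k /cK->; rewrite scaler0.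
rewrite !big_ord_recl a0 -addrA; congr (_ + _); rewrite -big_split /=.
by apply: eq_bigr => i _; rewrite aS scalerDr scalerA invr_factS.
Qed.

Lemma fsupp_lt (V : zmodType) (f : nat -> V) K :
  (forall k, (K <= k)%N -> f k = 0) -> fsupp f.
Proof.
by move=> fK; exists [fset i in iota 0 K]%fset => k; rewrite in_fset mem_iota -leqNgt => /fK.
Qed.

(** * Translations of the variables *)

Section Shift.
Variable t : nat -> F.
Local Notation dlt := (@shift_exponent F R t).
Local Notation sh := (@shift_exp F R t).

Lemma fsupp_shift_exponent v : fsupp (fun i => t i *: lower i v).
Proof.
have [B vB] := exists_vars_below v; apply: (fsupp_lt (K := B)) => i /vB->.
exact: scaler0.
Qed.

Lemma shift_exponent_linear : linear dlt.
Proof.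
apply: linear_fsum fsupp_shift_exponent => i a u v.
by rewrite lower_linear scalerDr !scalerA mulrC.
Qed.

Lemma iter_linear (f : M -> M) k : linear f -> linear (iter k f).
Proof. by move=> lf; elim: k => // k IH a u v; rewrite iterS IH lf. Qed.

Lemma shift_exponent_raise i v : dlt (raise i v) = raise i (dlt v) + t i *: v.
Proof.
rewrite (fsum_lin (raise_linear i) (fsupp_shift_exponent v)).
have -> : t i *: v = \sum_(j \in [set: nat]) t j *: ((j == i)%:R *: v).
  rewrite (fsbigTE [fset i]%fset); first by rewrite big_seq_fset1 eqxx scale1r.
  by move=> j; rewrite inE => /negPf->; rewrite scale0r scaler0.
rewrite -fsum_split.
- by apply: eq_fsbigr => j _; rewrite lower_raise scalerDr (linZ (raise_linear i)).
- by apply: fsupp_sub (fsupp_shift_exponent v) _ => j ->; rewrite (lin0 (raise_linear i)).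
- by exists [fset i]%fset => j; rewrite inE => /negPf->; rewrite scale0r scaler0.
Qed.

Lemma shift_exponent_lower i v : dlt (lower i v) = lower i (dlt v).
Proof.
rewrite (fsum_lin (lower_linear i) (fsupp_shift_exponent v)).
by apply: eq_fsbigr => j _; rewrite (linZ (lower_linear i)) lowerC.
Qed.

Lemma iter_shift_exponent_eq0 K k v : deg_below K v -> (K <= k)%N -> iter k dlt v = 0.
Proof.
move=> /deg_belowW vK /vK; elim: k v {vK} => // k IH v vk; rewrite iterSr.
have lk := iter_linear k shift_exponent_linear.
rewrite (fsum_lin lk (fsupp_shift_exponent v)) fsbig1 // => i _.
by rewrite (linZ lk) IH ?scaler0.
Qed.

Lemma fsupp_shift_exp v : fsupp (fun k => (k`!%:R)^-1 *: iter k dlt v).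
Proof.
have [K vK] := exists_deg_below v; apply: (fsupp_lt (K := K)) => k Kk.
by rewrite (iter_shift_exponent_eq0 vK Kk) scaler0.
Qed.

Lemma shift_exp_linear : linear sh.
Proof.
apply: linear_fsum fsupp_shift_exp => k a u v.
by rewrite (iter_linear k shift_exponent_linear) scalerDr !scalerA mulrC.
Qed.

Lemma shift_exp_raise i v : sh (raise i v) = raise i (sh v) + t i *: sh v.
Proof.
have [K vK] := exists_deg_below v.
rewrite [LHS](fsum_exp (b := fun k => raise i (iter k dlt v))
  (c := fun k => t i *: iter k dlt v) (K := K)).
- rewrite (fsum_lin (raise_linear i) (fsupp_shift_exp v)) (fsumZ _ (fsupp_shift_exp v)).
  congr (_ + _); apply: eq_fsbigr => k _; first by rewrite (linZ (raise_linear i)).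
  by rewrite !scalerA mulrC.
- by move=> k Kk; rewrite (iter_shift_exponent_eq0 vK Kk) (lin0 (raise_linear i)).
- by move=> k Kk; rewrite (iter_shift_exponent_eq0 vK Kk) scaler0.
- by [].
- elim=> [|k IH]; first by rewrite /= shift_exponent_raise scale1r.
  rewrite iterS IH (linD shift_exponent_linear) shift_exponent_raise -addrA.
  rewrite !(linZ shift_exponent_linear) -[in RHS]natr1 scalerDl scale1r.
  by rewrite [in RHS](addrC (k.+1%:R *: _)).
Qed.

Lemma shift_exp_vacuum : sh (vacuum R) = vacuum R.
Proof.
rewrite [LHS](fsum_nat (n := 1)); first by rewrite big_ord1 fact0 invr1 scale1r.
move=> k k1; rewrite (@iter_shift_exponent_eq0 1) ?scaler0 // => i.
by rewrite lower_vacuum.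
Qed.

Lemma lower_shift_exp i v : lower i (sh v) = sh (lower i v).
Proof.
rewrite (fsum_lin (lower_linear i) (fsupp_shift_exp v)).
apply: eq_fsbigr => k _; rewrite (linZ (lower_linear i)); congr (_ *: _).
by elim: k => //= k <-; rewrite shift_exponent_lower.
Qed.

End Shift.

Lemma shift_expK (t : nat -> F) (v : M) : shift_exp (fun i => - t i) (shift_exp t v) = v.
Proof.
elim/fock_ind: v => [|i v IH|a u v IHu IHv]; first by rewrite !shift_exp_vacuum.
  rewrite shift_exp_raise (linD (shift_exp_linear _)) shift_exp_raise.
  by rewrite (linZ (shift_exp_linear _)) IH scaleNr subrK.
by rewrite !shift_exp_linear IHu IHv.
Qed.

Lemma opiter0 (A : ropser R) j v : opiter A 0 j v = if j == 0 then v else 0.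
Proof. by []. Qed.

Lemma opiterS (A : ropser R) k j v :
  opiter A k.+1 j v = \sum_(i \in [set: int]) A i (opiter A k (j - i) v).
Proof. by []. Qed.

Opaque opiter.

(** * The annihilation exponential *)

Section Annihilation.
Variable c : F.
Local Notation A := (@rannihilation F R c).
Local Notation P := (opiter A).
Local Notation E := (ropexp A).

Lemma ann_linear j : linear (A j).
Proof.
move=> a u v; rewrite /rannihilation; case: eqP => _; first by rewrite scaler0 addr0.
by rewrite lower_linear scalerDr !scalerA mulrC.
Qed.

Lemma ann_lower j i v : A j (lower i v) = lower i (A j v).
Proof.
rewrite /rannihilation; case: eqP => _; first by rewrite (lin0 (lower_linear i)).
by rewrite (linZ (lower_linear i)) lowerC.
Qed.

Lemma ann_vars B j v : vars_below B v -> vars_below B (A j v).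
Proof. by move=> vB i iB; rewrite -ann_lower (vB i iB) (lin0 (ann_linear j)). Qed.

Lemma ann_eq0 B j v : vars_below B v -> (B < `|j|)%N -> A j v = 0.
Proof.
move=> vB Bj; rewrite /rannihilation vB; last by lia.
by rewrite scaler0; case: eqP.
Qed.

Lemma ann_raise j i v : A j (raise i v) = raise i (A j v) + (`|j| == i.+1)%N%:R *: (c *: v).
Proof.
rewrite /rannihilation; case: eqP => [->|j0].
  by rewrite (lin0 (raise_linear i)) scale0r addr0.
rewrite lower_raise scalerDr (linZ (raise_linear i)).
have -> : (`|j|.-1 == i)%N = (`|j| == i.+1)%N by lia.
by case: eqP => _; rewrite ?scale1r ?scale0r ?scaler0.
Qed.

(** The two claims go together: the coefficients of [A] beyond B vanish only on a vector in which no
    variable of index at least B occurs, and each application must preserve this. *)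
Lemma opiter_ann_vars_supp B k j v : vars_below B v ->
  vars_below B (P k j v) /\ ((k * B < `|j|)%N -> P k j v = 0).
Proof.
move=> vB; elim: k j => [|k IH] j.
  rewrite !opiter0; split; last by case: eqP => // ->.
  by case: eqP => // _ i _; rewrite (lin0 (lower_linear i)).
have fs : fsupp (fun i => A i (P k (j - i) v)).
  by apply: (fsupp_int (B := B)) => i; apply: ann_eq0; case: (IH (j - i)).
split.
  move=> i iB; rewrite opiterS (fsum_lin (lower_linear i) fs).
  by rewrite fsbig1 // => m _; have [vP _] := IH (j - m); apply: ann_vars iB.
move=> jB; rewrite opiterS fsbig1 // => i _.
have [vP sP] := IH (j - i); case: (ltnP B `|i|%N) => [/(ann_eq0 vP)//|iB].
by rewrite sP ?(lin0 (ann_linear i)) //; move: jB; rewrite mulSn; lia.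
Qed.

Lemma fsupp_opiter_ann k j v : fsupp (fun i => A i (P k (j - i) v)).
Proof.
have [B vB] := exists_vars_below v.
by apply: (fsupp_int (B := B)) => i; apply: ann_eq0; case: (opiter_ann_vars_supp k (j - i) vB).
Qed.

Lemma opiter_ann_linear k j : linear (P k j).
Proof.
elim: k j => [|k IH] j a u v.
  by rewrite !opiter0; case: eqP => // _; rewrite scaler0 addr0.
rewrite !opiterS; apply: (linear_fsum (f := fun i v => A i (P k (j - i) v))).
  by move=> i {}a {}u {}v; rewrite IH ann_linear.
exact: fsupp_opiter_ann.
Qed.

Lemma opiter_ann_lower k j i v : P k j (lower i v) = lower i (P k j v).
Proof.
elim: k j => [|k IH] j.
  by rewrite !opiter0; case: eqP => // _; rewrite (lin0 (lower_linear i)).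
rewrite !opiterS (fsum_lin (lower_linear i) (fsupp_opiter_ann _ _ _)).
by apply: eq_fsbigr => m _; rewrite IH ann_lower.
Qed.

Lemma opiter_ann_eq0 K k j v : deg_below K v -> (K <= k)%N -> P k j v = 0.
Proof.
move=> /deg_belowW vK /vK; elim: k j v {vK} => [|k IH] j v vk.
  by rewrite opiter0 vk; case: eqP.
rewrite opiterS fsbig1 // => i _; rewrite /rannihilation; case: eqP => // _.
by rewrite -opiter_ann_lower IH ?scaler0 //; apply: vk.
Qed.

Lemma fsum_two (V : lmodType F) (f : int -> V) (n : nat) :
  \sum_(i \in [set: int]) (`|i|%N == n.+1)%:R *: f i = f n.+1 + f (- n.+1%:Z).
Proof.
rewrite (fsbigTE [fset Posz n.+1; Negz n]%fset); last first.
  move=> i; rewrite !inE negb_or => /andP[/eqP i1 /eqP i2].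
  suff -> : (`|i|%N == n.+1) = false by rewrite scale0r.
  by apply/negP => /eqP; lia.
rewrite big_fsetU1 ?inE //= big_seq_fset1 /= !eqxx !scale1r.
by rewrite NegzE.
Qed.

Lemma opiter_ann_raise k j i v : P k.+1 j (raise i v) =
  raise i (P k.+1 j v) + k.+1%:R *: (c *: (P k (j - i.+1%:Z) v + P k (j + i.+1%:Z) v)).
Proof.
(* One more multiplication by [A], with the commutator term of the m-th power left as an arbitrary
   [Q]: it is 0 for m = 0 and given by the induction hypothesis afterwards. *)
have step m (Q : int -> M) l : (forall j, P m j (raise i v) = raise i (P m j v) + Q j) ->
    fsupp (fun i => A i (Q (l - i))) ->
    P m.+1 l (raise i v) = raise i (P m.+1 l v) +
      c *: (P m (l - i.+1%:Z) v + P m (l + i.+1%:Z) v) +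
      \sum_(n \in [set: int]) A n (Q (l - n)).
  move=> PQ fQ.
  have f1 := fsupp_opiter_ann m l v.
  have f2 : fsupp (fun n : int => (`|n| == i.+1)%N%:R *: (c *: P m (l - n) v)).
    apply: (fsupp_int (B := i.+1)) => n; rewrite ltnNge => mi.
    by case: eqP mi => [->|_ _]; rewrite ?leqnn // scale0r.
  have f1' : fsupp (fun n => raise i (A n (P m (l - n) v))).
    by apply: fsupp_sub f1 _ => n ->; rewrite (lin0 (raise_linear i)).
  have -> : P m.+1 l (raise i v) = \sum_(n \in [set: int])
      (raise i (A n (P m (l - n) v)) + (`|n| == i.+1)%N%:R *: (c *: P m (l - n) v)
       + A n (Q (l - n))).
    by rewrite opiterS; apply: eq_fsbigr => n _; rewrite PQ (linD (ann_linear n)) ann_raise.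
  rewrite (fsum_split (fsuppD f1' f2) fQ) (fsum_split f1' f2).
  have -> := fsum_two (fun n => c *: P m (l - n) v) i.
  by rewrite -(fsum_lin (raise_linear i) f1) -opiterS -scalerDr opprK.
elim: k j => [|k IH] j.
  rewrite (step _ (fun=> 0)).
  - rewrite fsbig1 ?addr0 ?scale1r // => n _; exact: lin0 (ann_linear n).
  - by move=> n; rewrite !opiter0 addr0; case: eqP => _; rewrite ?(lin0 (raise_linear i)).
  - by exists fset0 => n _; apply: lin0 (ann_linear n).
pose G n := A n (P k (j - i.+1%:Z - n) v) + A n (P k (j + i.+1%:Z - n) v).
have GQ n : A n (k.+1%:R *: (c *: (P k (j - n - i.+1%:Z) v + P k (j - n + i.+1%:Z) v))) =
    k.+1%:R *: (c *: G n).
  rewrite !(linZ (ann_linear n)) (linD (ann_linear n)) /G.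
  by rewrite [j - n - _]addrAC [j - n + _]addrAC.
have f3 : fsupp G by apply: fsuppD; apply: fsupp_opiter_ann.
have f4 : fsupp (fun n => c *: G n) by apply: fsupp_sub f3 _ => n ->; rewrite scaler0.
rewrite (step _ _ _ IH); last by apply: fsupp_sub f4 _ => n e; rewrite GQ e scaler0.
under eq_fsbigr do rewrite GQ.
rewrite -fsumZ // -fsumZ // fsum_split; try exact: fsupp_opiter_ann.
rewrite -!opiterS -addrA; congr (_ + _).
by rewrite -[in RHS]natr1 scalerDl scale1r addrC.
Qed.

Lemma ann_exp_bound v : exists B, forall k j, (B < `|j|)%N -> P k j v = 0.
Proof.
have [B vB] := exists_vars_below v; have [K vK] := exists_deg_below v.
exists (K * B)%N => k j jKB; case: (leqP K k) => [|kK]; first exact: opiter_ann_eq0.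
have [_ ->//] := opiter_ann_vars_supp k j vB.
by apply: leq_ltn_trans jKB; rewrite leq_mul2r (ltnW kK) orbT.
Qed.

Lemma fsupp_ann_exp v : fsupp (E^~ v).
Proof.
have [B vB] := ann_exp_bound v; apply: (fsupp_int (B := B)) => j jB.
by rewrite /ropexp fsbig1 // => k _; rewrite vB // scaler0.
Qed.

Lemma fsupp_ann_term j v : fsupp (fun k => (k`!%:R)^-1 *: P k j v).
Proof.
have [K vK] := exists_deg_below v; apply: (fsupp_lt (K := K)) => k Kk.
by rewrite (opiter_ann_eq0 _ vK Kk) scaler0.
Qed.

Lemma ann_exp_linear j : linear (E j).
Proof.
apply: linear_fsum (fsupp_ann_term j) => k a u v.
by rewrite opiter_ann_linear scalerDr !scalerA mulrC.
Qed.

Lemma ann_exp_lower j i v : E j (lower i v) = lower i (E j v).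
Proof.
rewrite (fsum_lin (lower_linear i) (fsupp_ann_term j v)).
by apply: eq_fsbigr => k _; rewrite (linZ (lower_linear i)) opiter_ann_lower.
Qed.

Lemma ann_exp_raise j i v : E j (raise i v) =
  raise i (E j v) + c *: (E (j - i.+1%:Z) v + E (j + i.+1%:Z) v).
Proof.
have [K vK] := exists_deg_below v.
rewrite [LHS](fsum_exp (b := fun k => raise i (P k j v))
  (c := fun k => c *: (P k (j - i.+1%:Z) v + P k (j + i.+1%:Z) v)) (K := K)).
- rewrite (fsum_lin (raise_linear i) (fsupp_ann_term j v)); congr (_ + _).
    by apply: eq_fsbigr => k _; rewrite (linZ (raise_linear i)).
  rewrite -(fsum_split (fsupp_ann_term _ _) (fsupp_ann_term _ _)) fsumZ.
    by apply: eq_fsbigr => k _; rewrite -scalerDr !scalerA mulrC.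
  exact: fsuppD (fsupp_ann_term _ _) (fsupp_ann_term _ _).
- by move=> k Kk; rewrite (opiter_ann_eq0 _ vK Kk) (lin0 (raise_linear i)).
- by move=> k Kk; rewrite !(opiter_ann_eq0 _ vK Kk) addr0 scaler0.
- by rewrite !opiter0; case: eqP => // _; rewrite (lin0 (raise_linear i)).
- by move=> k; apply: opiter_ann_raise.
Qed.

Lemma ann_exp_vacuum j : E j (vacuum R) = if j == 0 then vacuum R else 0.
Proof.
rewrite [LHS](fsum_nat (n := 1)); first by rewrite big_ord1 fact0 invr1 scale1r opiter0.
move=> k k1; rewrite (@opiter_ann_eq0 1) ?scaler0 // => i.
by rewrite lower_vacuum.
Qed.

End Annihilation.

(** * The creation exponential *)

Section Creation.
Variable c : F.
Local Notation A := (@rcreation F R c).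
Local Notation P := (opiter A).
Local Notation E := (ropexp A).

Lemma cre_linear j : linear (A j).
Proof.
move=> a u v; rewrite /rcreation; case: ifP => _; last by rewrite scaler0 addr0.
by rewrite raise_linear !scalerDr !scalerA; congr (_ *: _ + _); ring.
Qed.

Lemma cre_raise j i v : A j (raise i v) = raise i (A j v).
Proof.
rewrite /rcreation; case: ifP => _; last by rewrite (lin0 (raise_linear i)).
by rewrite !(linZ (raise_linear i)) raiseC.
Qed.

Lemma lower_cre j i v : lower i (A j v) = A j (lower i v) + (j == i.+1)%:R *: ((c / i.+1%:R) *: v).
Proof.
rewrite /rcreation; case: ifP => [j0|/negP j0]; last first.
  have -> : (j == i.+1) = false by lia.
  by rewrite scale0r addr0 (lin0 (lower_linear i)).
rewrite !(linZ (lower_linear i)) lower_raise !scalerDr; congr (_ + _).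
have -> : (i == `|j|.-1)%N = (j == i.+1) by lia.
by case: eqP => [->|_]; rewrite ?scale0r ?scaler0 // scale1r scalerA scale1r.
Qed.

Lemma opiter_cre_eq0 (k : nat) (j : int) v : j < k%:Z -> P k j v = 0.
Proof.
elim: k j => [|k IH] j jk; first by rewrite opiter0; case: eqP => // j0; lia.
rewrite opiterS fsbig1 // => i _; case: (ltrP 0 i) => i0.
  by rewrite IH ?(lin0 (cre_linear i)) //; lia.
by rewrite /rcreation ltNge i0.
Qed.

Lemma fsupp_opiter_cre k j v : fsupp (fun i => A i (P k (j - i) v)).
Proof.
apply: (fsupp_int (B := `|j|)) => i ij; case: (ltrP 0 i) => i0.
  by rewrite opiter_cre_eq0 ?(lin0 (cre_linear i)) //; lia.
by rewrite /rcreation ltNge i0.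
Qed.

Lemma opiter_cre_linear k j : linear (P k j).
Proof.
elim: k j => [|k IH] j a u v.
  by rewrite !opiter0; case: eqP => // _; rewrite scaler0 addr0.
rewrite !opiterS; apply: (linear_fsum (f := fun i v => A i (P k (j - i) v))).
  by move=> i {}a {}u {}v; rewrite IH cre_linear.
exact: fsupp_opiter_cre.
Qed.

Lemma opiter_cre_raise k j i v : P k j (raise i v) = raise i (P k j v).
Proof.
elim: k j => [|k IH] j.
  by rewrite !opiter0; case: eqP => // _; rewrite (lin0 (raise_linear i)).
rewrite !opiterS (fsum_lin (raise_linear i) (fsupp_opiter_cre _ _ _)).
by apply: eq_fsbigr => m _; rewrite IH cre_raise.
Qed.

Lemma vev_opiter_cre k j v : vev (P k.+1 j v) = 0.
Proof.
rewrite opiterS (fsum_lin (W := F^o) (@vev_linear F R) (fsupp_opiter_cre _ _ _)).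
rewrite fsbig1 // => i _; rewrite /rcreation; case: ifP => _.
  by rewrite !(linZ (@vev_linear F R)) vev_raise !scaler0.
exact: lin0 (@vev_linear F R).
Qed.

Lemma lower_opiter_cre k j i v : lower i (P k.+1 j v) =
  P k.+1 j (lower i v) + k.+1%:R *: ((c / i.+1%:R) *: P k (j - i.+1%:Z) v).
Proof.
have single l m : \sum_(n \in [set: int]) (n == i.+1)%:R *: ((c / i.+1%:R) *: P m (l - n) v)
    = (c / i.+1%:R) *: P m (l - i.+1%:Z) v.
  rewrite (@fsum_int1 _ _ i.+1%:Z); first by rewrite eqxx scale1r.
  by move=> n /negPf->; rewrite scale0r.
have f2 l m : fsupp (fun n : int => (n == i.+1)%:R *: ((c / i.+1%:R) *: P m (l - n) v)).
  apply: (fsupp_int (B := i.+1)) => n nB.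
  have -> : (n == i.+1) = false by lia.
  by rewrite scale0r.
elim: k j => [|k IH] j.
  rewrite !opiterS (fsum_lin (lower_linear i) (fsupp_opiter_cre _ _ _)) scale1r -single.
  rewrite -(fsum_split (fsupp_opiter_cre _ _ _) (f2 _ _)); apply: eq_fsbigr => n _.
  rewrite lower_cre !opiter0; congr (A _ _ + _).
  by case: eqP => // _; rewrite (lin0 (lower_linear i)).
rewrite opiterS (fsum_lin (lower_linear i) (fsupp_opiter_cre _ _ _)).
have f1 := fsupp_opiter_cre k.+1 j (lower i v).
have f3 := fsupp_opiter_cre k (j - i.+1%:Z) v.
have f4 : fsupp (fun n => (k.+1%:R * (c / i.+1%:R)) *: A n (P k (j - i.+1%:Z - n) v)).
  by apply: fsupp_sub f3 _ => n ->; rewrite scaler0.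
have -> : \sum_(n \in [set: int]) lower i (A n (P k.+1 (j - n) v)) = \sum_(n \in [set: int])
   (A n (P k.+1 (j - n) (lower i v)) + (k.+1%:R * (c / i.+1%:R)) *: A n (P k (j - i.+1%:Z - n) v)
     + (n == i.+1)%:R *: ((c / i.+1%:R) *: P k.+1 (j - n) v)).
  apply: eq_fsbigr => n _; rewrite lower_cre IH (linD (cre_linear n)); congr (_ + _ + _).
  by rewrite !(linZ (cre_linear n)) scalerA addrAC.
rewrite (fsum_split (fsuppD f1 f4) (f2 _ _)) (fsum_split f1 f4) -fsumZ // -!opiterS single.
by rewrite -addrA scalerA -scalerDl -[in RHS]natr1 mulrDl mul1r.
Qed.

Lemma fsupp_cre_term j v : fsupp (fun k => (k`!%:R)^-1 *: P k j v).
Proof.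
apply: (fsupp_lt (K := `|j|.+1)) => k Kk.
by rewrite opiter_cre_eq0 ?scaler0 //; lia.
Qed.

Lemma cre_exp_linear j : linear (E j).
Proof.
apply: linear_fsum (fsupp_cre_term j) => k a u v.
by rewrite opiter_cre_linear scalerDr !scalerA mulrC.
Qed.

Lemma cre_exp_raise j i v : E j (raise i v) = raise i (E j v).
Proof.
rewrite (fsum_lin (raise_linear i) (fsupp_cre_term j v)).
by apply: eq_fsbigr => k _; rewrite (linZ (raise_linear i)) opiter_cre_raise.
Qed.

Lemma cre_exp_lt0 j v : j < 0 -> E j v = 0.
Proof.
move=> j0; rewrite /ropexp fsbig1 // => k _.
by rewrite opiter_cre_eq0 ?scaler0 //; lia.
Qed.

Lemma lower_cre_exp j i v : lower i (E j v) =
  E j (lower i v) + (c / i.+1%:R) *: E (j - i.+1%:Z) v.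
Proof.
rewrite (fsum_lin (lower_linear i) (fsupp_cre_term j v)).
under eq_fsbigr do rewrite (linZ (lower_linear i)).
rewrite (fsum_exp (b := fun k => P k j (lower i v))
  (c := fun k => (c / i.+1%:R) *: P k (j - i.+1%:Z) v) (K := (`|j| + i.+1).+1)).
- congr (_ + _); rewrite fsumZ; last exact: fsupp_cre_term.
  by apply: eq_fsbigr => k _; rewrite !scalerA mulrC.
- by move=> k Kk; rewrite opiter_cre_eq0 //; lia.
- by move=> k Kk; rewrite opiter_cre_eq0 ?scaler0 //; lia.
- by rewrite !opiter0; case: eqP => // _; rewrite (lin0 (lower_linear i)).
- by move=> k; apply: lower_opiter_cre.
Qed.

Lemma vev_cre_exp j v : vev (E j v) = if j == 0 then vev v else 0.
Proof.
rewrite (fsum_lin (W := F^o) (@vev_linear F R) (fsupp_cre_term j v)).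
rewrite (fsbigTE [fset 0%N]%fset).
  rewrite big_seq_fset1 fact0 invr1 scale1r opiter0; case: eqP => // _.
  exact: lin0 (@vev_linear F R).
case=> [|k]; first by rewrite inE eqxx.
by rewrite (linZ (@vev_linear F R)) vev_opiter_cre scaler0.
Qed.

End Creation.

(** * Commutation rules of the vertex operators *)

Section Vertex.
Variables (s c : F).
Local Notation V := (@vertex F R s c).
Local Notation C := (ropexp (rcreation c)).
Local Notation N := (ropexp (rannihilation (- c))).

Let K j v := C j v + s *: C (j - 1) v.

Let K_binomial j v : ropmul (rbinomial s) C j v = K j v.
Proof.
rewrite /ropmul (fsbigTE [fset 0; 1]%fset).
  by rewrite big_fsetU1 ?inE //= big_seq_fset1 /rbinomial /= subr0.
move=> i; rewrite !inE negb_or /rbinomial => /andP[/negPf-> /negPf->].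
by [].
Qed.

Let K_linear j : linear (K j).
Proof.
move=> a u v; rewrite /K !cre_exp_linear !scalerDr !scalerA mulrC.
by rewrite addrACA.
Qed.

(** The summation index is moved to the annihilation factor, which acts first: only finitely many of
    its coefficients are nonzero on a given vector, whatever [j] is. *)
Lemma vertexE j v : V j v = \sum_(i \in [set: int]) K (j - i) (N i v).
Proof.
rewrite /vertex [LHS](_ : _ = \sum_(i \in [set: int]) K i (N (j - i) v)).
  rewrite (reindex_fsbigT (fun i => j - i)).
    by apply: eq_fsbigr => i _; rewrite subKr.
  by exists (fun i => j - i) => i; rewrite subKr.
by apply: eq_fsbigr => i _; rewrite K_binomial.
Qed.

Lemma fsupp_vertex j v : fsupp (fun i => K (j - i) (N i v)).
Proof. by apply: fsupp_sub (fsupp_ann_exp (- c) v) _ => i ->; apply: lin0 (K_linear _). Qed.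

Lemma vertex_linear j : linear (V j).
Proof.
move=> a u v; rewrite !vertexE.
apply: (linear_fsum (f := fun i v => K (j - i) (N i v))) (fsupp_vertex j) _ _ _ => i {}a {}u {}v.
by rewrite ann_exp_linear K_linear.
Qed.

(** Coefficient form of [V(z), a_{-n}] = - c (z^n + z^-n) V(z) with n = i+1; only the annihilation
    factor fails to commute with a_{-n}. *)
Lemma vertex_raise j i v : V j (raise i v) =
  raise i (V j v) - c *: (V (j - i.+1%:Z) v + V (j + i.+1%:Z) v).
Proof.
have shiftV n : \sum_(m \in [set: int]) K (j - m) (N (m - n) v) = V (j - n) v.
  rewrite vertexE -[RHS](fsum_shift _ n); apply: eq_fsbigr => m _.
  by congr K; lia.
have fs n : fsupp (fun m => K (j - m) (N (m - n) v)).
  apply: fsupp_sub (fsupp_shift n (fsupp_ann_exp (- c) v)) _ => m ->.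
  exact: lin0 (K_linear _).
have KX l w : K l (raise i w) = raise i (K l w).
  by rewrite /K !cre_exp_raise (linD (raise_linear i)) (linZ (raise_linear i)).
have jn : j + i.+1%:Z = j - (- i.+1%:Z) by rewrite opprK.
have f1 : fsupp (fun m => raise i (K (j - m) (N m v))).
  by apply: fsupp_sub (fsupp_vertex j v) _ => m ->; apply: lin0 (raise_linear i).
have f2 := fsuppD (fs i.+1%:Z) (fs (- i.+1%:Z)).
rewrite jn -(shiftV i.+1%:Z) -(shiftV (- i.+1%:Z)) -(fsum_split (fs _) (fs _)).
rewrite -scaleNr (fsumZ _ f2) !vertexE (fsum_lin (raise_linear i) (fsupp_vertex j v)).
rewrite -fsum_split //; last by apply: fsupp_sub f2 _ => m ->; rewrite scaler0.
apply: eq_fsbigr => m _; rewrite ann_exp_raise (linD (K_linear _)) (linZ (K_linear _)) KX.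
by rewrite (linD (K_linear _)) opprK.
Qed.

(** Coefficient form of [d/da_{-n}, V(z)] = (c/n) z^n V(z) with n = i+1; here only the creation
    factor contributes. *)
Lemma lower_vertex j i v : lower i (V j v) =
  V j (lower i v) + (c / i.+1%:R) *: V (j - i.+1%:Z) v.
Proof.
have lK l w : lower i (K l w) = K l (lower i w) + (c / i.+1%:R) *: K (l - i.+1%:Z) w.
  rewrite /K (linD (lower_linear i)) (linZ (lower_linear i)) !lower_cre_exp.
  rewrite !scalerDr !scalerA addrACA; congr (_ + (_ + _)); rewrite mulrC; congr (_ *: C _ _).
  by rewrite addrAC.
rewrite !vertexE (fsum_lin (lower_linear i) (fsupp_vertex j v)).
rewrite (fsumZ _ (fsupp_vertex _ _)) -fsum_split; last 2 first.
- exact: fsupp_vertex.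
- by apply: fsupp_sub (fsupp_vertex (j - i.+1%:Z) v) _ => m ->; rewrite scaler0.
by apply: eq_fsbigr => m _; rewrite lK ann_exp_lower [j - m - _]addrAC.
Qed.

Let vertex_vacuumE j : V j (vacuum R) = K j (vacuum R).
Proof.
rewrite vertexE (@fsum_int1 _ _ 0); first by rewrite ann_exp_vacuum eqxx subr0.
by move=> i /negPf i0; rewrite ann_exp_vacuum i0 (lin0 (K_linear _)).
Qed.

Lemma vertex_vacuum_lt0 j : j < 0 -> V j (vacuum R) = 0.
Proof.
move=> j0; rewrite vertex_vacuumE /K !cre_exp_lt0 ?scaler0 ?addr0 //.
by rewrite ltrBlDr (lt_trans j0).
Qed.

Lemma vev_vertex_vacuum j : vev (V j (vacuum R)) = (j == 0)%:R + s * (j == 1)%:R.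
Proof.
rewrite vertex_vacuumE /K (linD (@vev_linear F R)) (linZ (@vev_linear F R)) !vev_cre_exp.
rewrite vev_vacuum subr_eq0; congr (_ + _ * _); by case: eqP.
Qed.

End Vertex.
End Exponentials.

(** * Horizontal strips *)

Section Strips.
Variable F : fieldType.
Hypothesis pchar0 : [pchar F] =i pred0.
Implicit Types (L : seq (nat * (nat -> F))) (G : seq nat -> F).

(* A letter (m, w) ranges over the integers a >= m, with weight w a. *)
Fixpoint box_sum B L G : F :=
  if L is l :: L' then \sum_(l.1 <= a < B) l.2 a * box_sum B L' (fun s => G (a :: s)) else G [::].

(** After a letter with lower bound m the next one is at most m: the chosen integers interlace the
    lower bounds, which is the horizontal strip condition. *)
Fixpoint strip_sum b L G : F :=
  if L is l :: L' then \sum_(l.1 <= a < b) l.2 a * strip_sum l.1.+1 L' (fun s => G (a :: s))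
  else G [::].

(** The equation says that exchanging the values (a, b+1) and (b, a+1) of two neighbouring letters
    preserves the product of their weights. The inequality lets the range of the second letter be
    cut at the strip bound. *)
Fixpoint compatible L : Prop :=
  if L is l :: L' then
    (if L' is l' :: _ then (l'.1 <= l.1.+1)%N /\ (forall a b, (l.1 <= a)%N -> (l.1 <= b)%N ->
      l.2 a * l'.2 b.+1 = l.2 b * l'.2 a.+1) else True) /\ compatible L'
  else True.

Definition alternating G :=
  forall s a b s', G (s ++ [:: a, b.+1 & s']) = - G (s ++ [:: b, a.+1 & s']).

Definition bounded B G := forall s, has (leq B) s -> G s = 0.

Lemma alternating_cons G a : alternating G -> alternating (fun s => G (a :: s)).
Proof. by move=> altG s b c s'; apply: (altG (a :: s)). Qed.

Lemma bounded_cons B G a : bounded B G -> bounded B (fun s => G (a :: s)).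
Proof. by move=> bG s sB; apply: bG; rewrite /= sB orbT. Qed.

Lemma eq_strip_sum b L G G' : (forall s, G s = G' s) -> strip_sum b L G = strip_sum b L G'.
Proof.
elim: L b G G' => [|l L IH] b G G' GG' /=; first exact: GG'.
by apply: eq_bigr => a _; congr (_ * _); apply: IH => s; apply: GG'.
Qed.

Lemma strip_sum0 b L G : (forall s, G s = 0) -> strip_sum b L G = 0.
Proof.
elim: L b G => [|l L IH] b G G0 /=; first exact: G0.
by apply: big1 => a _; rewrite IH ?mulr0.
Qed.

Lemma strip_sumN b L G : strip_sum b L (fun s => - G s) = - strip_sum b L G.
Proof.
elim: L b G => [|l L IH] b G //=; rewrite -sumrN.
by apply: eq_bigr => a _; rewrite IH mulrN.
Qed.

Lemma eq_box_sum B L G G' : (forall s, G s = G' s) -> box_sum B L G = box_sum B L G'.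
Proof.
elim: L G G' => [|l L IH] G G' GG' /=; first exact: GG'.
by apply: eq_bigr => a _; congr (_ * _); apply: IH => s; apply: GG'.
Qed.

(* Exchanging neighbouring letters cancels all the terms in which a letter exceeds the
   lower bound of the preceding one. *)
Lemma box_sum_strip_sum B L G : compatible L -> alternating G -> bounded B G ->
  box_sum B L G = strip_sum B L G.
Proof.
elim: L G => [|[m w] L IH] G //= [mw cL] altG bG.
have {}IH a : box_sum B L (fun s => G (a :: s)) = strip_sum B L (fun s => G (a :: s)).
  by apply: IH cL _ _; [apply: alternating_cons | apply: bounded_cons].
under eq_bigr do rewrite IH.
case: L mw cL {IH} => [|[m' w'] L] //= [m'm sym] _.
have [Bm|mB] := leqP B m; first by rewrite !big_geq.
pose H a b := strip_sum m'.+1 L (fun s => G [:: a, b & s]).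
have altH a b : H a b.+1 = - H b a.+1.
  by rewrite /H -strip_sumN; apply: eq_strip_sum => s; apply: (altG [::]).
have H0 a : H a B = 0 by apply: strip_sum0 => s; apply: bG; rewrite /= leqnn orbT.
(* The values b > m of the second letter are those beyond the strip bound. *)
suff S0 : \sum_(m <= a < B) w a * (\sum_(m.+1 <= b < B) w' b * H a b) = 0.
  rewrite -[RHS]addr0 -[X in _ = _ + X]S0 -[RHS]big_split; apply: eq_bigr => a _ /=.
  by rewrite -mulrDr; congr (_ * _); apply: big_cat_nat; rewrite ?m'm.
(* Replacing b by b+1 gives the range m <= b < B-1. The value b = B-1 can be added by [H0], and the
   range becomes a square on which a and b can be exchanged. *)
have E : \sum_(m <= a < B) w a * (\sum_(m.+1 <= b < B) w' b * H a b) =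
    \sum_(m <= a < B) \sum_(m <= b < B) w a * w' b.+1 * H a b.+1.
  have [B' BE] : exists B', B = B'.+1 by exists B.-1; lia.
  apply: eq_bigr => a _; move: mB (H0 a); rewrite BE => mB HB.
  rewrite mulr_sumr big_add1 [RHS]big_nat_recr /=; last by lia.
  by rewrite HB mulr0 addr0; apply: eq_bigr => b _; rewrite mulrA.
have : \sum_(m <= a < B) \sum_(m <= b < B) w a * w' b.+1 * H a b.+1 =
     - \sum_(m <= a < B) \sum_(m <= b < B) w a * w' b.+1 * H a b.+1.
  rewrite [in RHS]exchange_big /= -sumrN; apply: eq_big_nat => a /andP[ma _].
  rewrite -sumrN; apply: eq_big_nat => b /andP[mb _].
  by rewrite altH mulrN sym.
(* The sum equals its opposite, and 2 is nonzero. *)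
rewrite E => /eqP; rewrite -subr_eq0 opprK -mulr2n (mulrSn_eq0 pchar0) => /eqP.
exact.
Qed.

Lemma box_sum_rcons B L l G : box_sum B (rcons L l) G =
  box_sum B L (fun s => \sum_(l.1 <= a < B) l.2 a * G (rcons s a)).
Proof. by elim: L G => [|l' L IH] G //=; apply: eq_bigr => a _; rewrite IH. Qed.

Fixpoint strips b (ms : seq nat) : seq (seq nat) :=
  if ms is m :: ms' then [seq a :: s | a <- index_iota m b, s <- strips m.+1 ms'] else [:: [::]].

Lemma strips_path a b ms s : (b <= a.+1)%N -> s \in strips b ms -> path geq a s.
Proof.
elim: ms a b s => [|m ms IH] a b s ba /=; first by rewrite inE => /eqP->.
case/allpairsPdep => c [s' [cb s's ->]] /=.
rewrite mem_index_iota in cb; case/andP: cb => mc cb.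
by rewrite (IH c _ _ _ s's) // andbT /geq /=; lia.
Qed.

Lemma strips_sorted b ms s : s \in strips b ms -> sorted geq s.
Proof. by move=> /(strips_path (leqnSn b)); apply: path_sorted. Qed.

Fixpoint weight L (s : seq nat) : F :=
  match L, s with
  | l :: L', a :: s' => l.2 a * weight L' s'
  | _, _ => 1
  end.

Lemma strip_sumE b L G : strip_sum b L G = \sum_(s <- strips b (map fst L)) weight L s * G s.
Proof.
elim: L b G => [|l L IH] b G /=; first by rewrite big_seq1 mul1r.
rewrite big_allpairs_dep; apply: eq_bigr => a _.
by rewrite IH mulr_sumr; apply: eq_bigr => s _; rewrite mulrA.
Qed.

Definition power_letters (y : F) (ms : seq nat) : seq (nat * (nat -> F)) :=
  [seq (m, fun a => y ^+ (a - m)) | m <- ms].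

Lemma map_fst_power_letters y ms : map fst (power_letters y ms) = ms.
Proof. by rewrite -map_comp map_id_in. Qed.

Lemma compatible_power_letters y ms : sorted geq ms -> compatible (power_letters y ms).
Proof.
elim: ms => //= m [|m' ms] IH //= /andP[m'm ms_sorted]; split; last exact: IH.
split=> [|a b ma mb]; first exact: leqW.
by rewrite -!exprD; congr (_ ^+ _); move: m'm; rewrite /geq /=; lia.
Qed.

(** The product y^(a-m) w(b+1) = (y + 1) y^(a+b-m) depends only on a + b. The condition involves [w]
    only at successors, so its exceptional value at 0 is free. *)
Lemma compatible_power_letters_rcons y ms (w : nat -> F) : sorted geq ms ->
  (forall b, w b.+1 = y ^+ b.+1 + y ^+ b) ->
  compatible (rcons (power_letters y ms) (0%N, w)).
Proof.
move=> + wE; elim: ms => //= m [|m' ms] IH //= ms_sorted; last first.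
  case/andP: ms_sorted => m'm ms_sorted; split; last exact: IH.
  split=> [|a b ma mb]; first exact: leqW.
  by rewrite -!exprD; congr (_ ^+ _); move: m'm; rewrite /geq /=; lia.
split=> //; split=> // a b ma mb; rewrite !wE !mulrDr -!exprD.
by congr (_ ^+ _ + _ ^+ _); lia.
Qed.

Lemma weight_power_letters y b ms s : s \in strips b ms ->
  weight (power_letters y ms) s * y ^+ sumn ms = y ^+ sumn s.
Proof.
elim: ms b s => [|m ms IH] b s /=; first by rewrite inE => /eqP->; rewrite mulr1.
case/allpairsPdep => a [s' [ab s's ->]] /=.
rewrite mem_index_iota in ab; case/andP: ab => ma _.
rewrite [y ^+ (m + _)]exprD mulrACA (IH _ _ s's) -exprD subnK //.
by rewrite -exprD.
Qed.

End Strips.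

(** * Relations between vertex operators *)

Section VertexRelations.
Variable F : fieldType.
Hypothesis pchar0 : [pchar F] =i pred0.
Variable R : fock_rep F.
Local Notation M := (fsort R).
Local Notation V e := (@vertex F R e e).
Local Notation vac := (vacuum R).
Implicit Types (u v w : M).

Let vevD u v : vev (u + v) = vev u + vev v. Proof. exact: linD (@vev_linear F R) u v. Qed.
Let vevN v : vev (- v) = - vev v. Proof. exact: linN (@vev_linear F R) v. Qed.
Let vevZ a v : vev (a *: v) = a * vev v. Proof. exact: linZ (@vev_linear F R) a v. Qed.
Let vev0 : vev (0 : M) = 0. Proof. exact: lin0 (@vev_linear F R). Qed.

Let VD e j := linD (@vertex_linear F R e e j).
Let VZ e j := linZ (@vertex_linear F R e e j).
Let V0 e j := lin0 (@vertex_linear F R e e j).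
Let Vraise e := @vertex_raise F pchar0 R e e.
Let Vlower e := @lower_vertex F pchar0 R e e.
Let Vlt0 e j : j < 0 -> V e j vac = 0.
Proof. by move=> j0; apply: vertex_vacuum_lt0. Qed.
Opaque vertex.

(** Induction on the vector reduces the claim to the vacuum, where [fock_family_eq0] applies. Two
    terms are allowed in a derivative because differentiating a product of two vertex operators
    lowers the index of either one. *)
Lemma operator_family_eq0 (I : Type) (D : I -> M -> M) :
  (forall a, linear (D a)) -> (forall a, vev (D a vac) = 0) ->
  (forall i a, exists c1 a1 c2 a2, lower i (D a vac) = c1 *: D a1 vac + c2 *: D a2 vac) ->
  (forall i a v, (forall b, D b v = 0) -> D a (raise i v) = 0) ->
  forall a v, D a v = 0.
Proof.
move=> lD Dv Dl Dr a v; elim/fock_ind: v a => [|i v IH|b u v IHu IHv] a.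
- exact: fock_family_eq0 (fun a => D a vac) Dv Dl a.
- exact: Dr.
- by rewrite lD IHu IHv scaler0 addr0.
Qed.

(** * Newton recursion for a vertex operator on the vacuum *)

Section Newton.
Variable e : F.

(* Logarithmic derivative of V(z)|0> = exp (\sum_n (e a_{-n} - (-e)^n) z^n / n) |0>. *)
Let G (j : int) : M := \sum_(k \in [set: nat])
  (e *: raise k (V e (j - k.+1%:Z) vac) - (- e) ^+ k.+1 *: V e (j - k.+1%:Z) vac).

Let V_lt0 (j : int) (k : nat) : (j <= k%:Z)%R -> V e (j - k.+1%:Z) vac = 0.
Proof. by move=> jk; apply: vertex_vacuum_lt0 => //; lia. Qed.

Lemma vertex_vacuum0 : V e 0 vac = vac.
Proof.
apply/eqP; rewrite -subr_eq0; apply/eqP.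
apply: (@fock_family_eq0 F R unit (fun=> V e 0 vac - vac)) => [_|i _|]; last exact: tt.
  by rewrite vevD vevN vev_vertex_vacuum // vev_vacuum mulr0 addr0 subrr.
exists 0, tt, 0, tt; rewrite !scale0r addr0 (linD (lower_linear i)) (linN (lower_linear i)).
by rewrite Vlower lower_vacuum V0 vertex_vacuum_lt0 // scaler0 addr0 subrr.
Qed.

Let lower_V i (j : int) : lower i (V e j vac) = (e / i.+1%:R) *: V e (j - i.+1%:Z) vac.
Proof. by rewrite Vlower lower_vacuum V0 add0r. Qed.

Let lower_G i (j : int) :
  lower i (G j) = (e / i.+1%:R) *: G (j - i.+1%:Z) + e *: V e (j - i.+1%:Z) vac.
Proof.
have fG l : fsupp (fun k => e *: raise k (V e (l - k.+1%:Z) vac)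
                    - (- e) ^+ k.+1 *: V e (l - k.+1%:Z) vac).
  apply: (fsupp_lt (K := `|l|)) => k jk; rewrite V_lt0; last by lia.
  by rewrite (lin0 (raise_linear k)) !scaler0 subr0.
rewrite (fsum_lin (lower_linear i) (fG j)) (fsumZ _ (fG _)).
have -> : e *: V e (j - i.+1%:Z) vac =
    \sum_(k \in [set: nat]) (i == k)%:R *: (e *: V e (j - k.+1%:Z) vac).
  rewrite (fsbigTE [fset i]%fset); first by rewrite big_seq_fset1 eqxx scale1r.
  by move=> k; rewrite inE eq_sym => /negPf->; rewrite scale0r.
rewrite -fsum_split; last 2 first.
- by apply: fsupp_sub (fG (j - i.+1%:Z)) _ => k ->; rewrite scaler0.
- exists [fset i]%fset => k; rewrite inE eq_sym => /negPf->; exact: scale0r.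
apply: eq_fsbigr => k _.
rewrite (linD (lower_linear i)) (linN (lower_linear i)) !(linZ (lower_linear i)) lower_raise !lower_V.
rewrite (linZ (raise_linear k)) scalerDr scalerBr !scalerA [j - _ - _]addrAC.
rewrite -!addrA; congr (_ *: _ + _); first by rewrite mulrC.
by rewrite addrC; congr (- (_ *: _) + _ *: _); rewrite mulrC.
Qed.

(** Coefficient form of z V'(z) = (z d/dz log V(z)) V(z) on the vacuum. The exponential is not
    differentiated: the difference of the two sides, as a family in j, is mapped by [lower i] to a
    multiple of its member of index j - (i+1), and its vacuum expectations vanish. *)
Lemma vertex_newton_int (j : int) : j%:~R *: V e j vac = G j.
Proof.
apply/eqP; rewrite -subr_eq0; apply/eqP.
apply: (@fock_family_eq0 F R int (fun j => j%:~R *: V e j vac - G j)) => [{}j|i {}j].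
  rewrite vevD vevN vevZ vev_vertex_vacuum //.
  rewrite (fsum_morph vev0 vevD); last first.
    apply: (fsupp_lt (K := `|j|)) => k jk; rewrite V_lt0; last by lia.
    by rewrite (lin0 (raise_linear k)) !scaler0 subr0.
  have E k : vev (e *: raise k (V e (j - k.+1%:Z) vac) - (- e) ^+ k.+1 *: V e (j - k.+1%:Z) vac)
    = - ((- e) ^+ k.+1 * ((j == k.+1)%:R + e * (j == k.+2)%:R)).
    rewrite vevD vevN !vevZ vev_raise vev_vertex_vacuum //.
    rewrite mulr0 add0r subr_eq0; congr (- (_ * (_ + _ * _%:R))).
    by apply/eqP/eqP; lia.
  under eq_fsbigr do rewrite E.
  case: j {E} => [[|m]|m].
  - rewrite fsbig1; first by rewrite subr0 mulr0z mul0r.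
    by move=> k _; rewrite mulr0 addr0 mulr0 oppr0.
  - rewrite (fsum_nat (n := m.+1)); last first.
      move=> k mk; have [-> ->] : (m.+1%:Z == k.+1) = false /\ (m.+1%:Z == k.+2) = false by lia.
      by rewrite mulr0 addr0 mulr0 oppr0.
    rewrite big_ord_recr /= eqxx.
    have -> : (m.+1%:Z == m.+2) = false by lia.
    case: m => [|m].
      by rewrite big_ord0 expr1 eqxx /= !mulr1n !mulr0n; ring.
    rewrite big_ord_recr /= big1; last first.
      move=> k _; have := ltn_ord k => km.
      have [-> ->] : (m.+2%:Z == k.+1) = false /\ (m.+2%:Z == k.+2) = false by lia.
      by rewrite mulr0 addr0 mulr0 oppr0.
    have -> : (m.+2%:Z == m.+1) = false by lia.
    by rewrite eqxx /= !mulr1n !mulr0n [(- e) ^+ m.+2]exprS; ring.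
  - rewrite fsbig1; first by rewrite subr0 mulr0 addr0 mulr0.
    by move=> k _; rewrite mulr0 addr0 mulr0 oppr0.
exists (e / i.+1%:R), (j - i.+1%:Z), 0, 0; rewrite scale0r addr0.
rewrite (linD (lower_linear i)) (linN (lower_linear i)) (linZ (lower_linear i)) lower_V lower_G.
rewrite scalerBr !scalerA opprD addrA addrAC -scalerBl; congr (_ *: _ - _).
rewrite rmorphB /= mulrBr mulrC divfK // natrS_neq0 //.
Qed.

Lemma vertex_newton (m : nat) : m%:R *: V e m vac = \sum_(r < m)
  (e *: raise (m - r.+1) (V e r vac) - (- e) ^+ (m - r) *: V e r vac).
Proof.
have := vertex_newton_int m; rewrite -pmulrn => ->.
rewrite /G (fsum_nat (n := m)); last first.
  move=> k mk; rewrite V_lt0; last by lia.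
  by rewrite (lin0 (raise_linear k)) !scaler0 subr0.
rewrite (reindex_inj rev_ord_inj); apply: eq_bigr => r _ /=.
have rm := ltn_ord r.
have -> : (m - r.+1).+1 = (m - r)%N by lia.
by have -> : m%:Z - (m - r)%N%:Z = r%:Z by lia.
Qed.

End Newton.

(** The recursion is applied to the inner operator; its [raise] is moved to the left, where the
    vacuum functional kills it, leaving shifts of [p]. This determines all expectations by induction
    on [m]. *)
Lemma vev_newton (e e' : F) (p : int) (m : nat) :
  m%:R * vev (V e p (V e' m vac)) = \sum_(r < m)
    (- (e * e') * (vev (V e (p - (m - r)%N%:Z) (V e' r vac)) + vev (V e (p + (m - r)%N%:Z) (V e' r vac)))
     - (- e') ^+ (m - r) * vev (V e p (V e' r vac))).
Proof.
have := vertex_newton e' m => /(congr1 (V e p)) /(congr1 (@vev F R)).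
rewrite VZ vevZ => ->; rewrite (lin_sum (@vertex_linear F R e e p)).
rewrite (big_morph _ vevD vev0); apply: eq_bigr => r _; have rm := ltn_ord r.
rewrite VD (linN (@vertex_linear F R e e p)) !VZ vevD vevN !vevZ Vraise vevD vevN vevZ vevD vev_raise.
have -> : (m - r.+1).+1 = (m - r)%N by lia.
by ring.
Qed.

(** * Two-point vacuum expectations *)

Section MixedConstants.
Variable e : F.
Hypothesis e2 : e * e = 1.

(** This is the recursion of [vev_newton] for the closed form proved next. From m to m + 2 the
    powers of e do not change, as e^2 = 1; each of the first two sums gains one term at either end,
    and these four match the two new terms of the third. *)
Let cancelling_sum (p : int) (m : nat) : \sum_(r < m)
  ((p == m%:Z - r.*2%:Z)%:R + e * (p == r.*2.+1%:Z - m%:Z)%:R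
   - e ^+ (m - r) * ((p == - r%:Z)%:R + e * (p == r.+1)%:R)) = 0.
Proof.
have [n nm] := ubnP m; elim: n m nm => // n IH [|[|m]] nm; first by rewrite big_ord0.
  rewrite big_ord1 subn0 expr1 subr0 oppr0 mulrDr mulrA e2 mul1r.
  by rewrite [X in X - _]addrC subrr.
have {}IH := IH m (leq_trans (leqnSn _) nm).
pose f1 (m r : nat) : F := (p == m%:Z - r.*2%:Z)%:R.
pose f2 (m r : nat) : F := e * (p == r.*2.+1%:Z - m%:Z)%:R.
pose f3 (r : nat) : F := (p == - r%:Z)%:R + e * (p == r.+1)%:R.
have {}IH : \sum_(r < m) f1 m r + \sum_(r < m) f2 m r = \sum_(r < m) e ^+ (m - r) * f3 r.
  by apply/eqP; rewrite -subr_eq0 -big_split -sumrB; apply/eqP.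
have S1 : \sum_(r < m.+2) f1 m.+2 r = f1 m.+2 0%N + (\sum_(r < m) f1 m r + f1 m m).
  rewrite big_ord_recl big_ord_recr /=; congr (_ + (_ + _)).
    by apply: eq_bigr => r _; rewrite /f1 /bump; congr (nat_of_bool (_ == _))%:R; lia.
  by rewrite /f1 /bump; congr (nat_of_bool (_ == _))%:R; lia.
have S2 : \sum_(r < m.+2) f2 m.+2 r = f2 m.+2 0%N + (\sum_(r < m) f2 m r + f2 m m).
  rewrite big_ord_recl big_ord_recr /=; congr (_ + (_ + _)).
    by apply: eq_bigr => r _; rewrite /f2 /bump; congr (_ * (nat_of_bool (_ == _))%:R); lia.
  by rewrite /f2 /bump; congr (_ * (nat_of_bool (_ == _))%:R); lia.
have S3 : \sum_(r < m.+2) e ^+ (m.+2 - r) * f3 r =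
    \sum_(r < m) e ^+ (m - r) * f3 r + f3 m + e * f3 m.+1.
  rewrite 2!big_ord_recr /=; have [-> ->] : (m.+2 - m = 2)%N /\ (m.+2 - m.+1 = 1)%N by lia.
  rewrite expr1 expr2 e2 mul1r.
  congr (_ + _ + _); apply: eq_bigr => r _; have rm := ltn_ord r.
  have -> : (m.+2 - r = 2 + (m - r))%N by lia.
  by rewrite exprD expr2 e2 mul1r.
rewrite (eq_bigr (fun r : 'I_m.+2 => f1 m.+2 r + f2 m.+2 r - e ^+ (m.+2 - r) * f3 r)) //.
rewrite big_split sumrN big_split S1 S2 S3 /= -IH /f3 mulrDr mulrA e2 mul1r /f1 /f2.
have -> : (p == m.+2%:Z - 0%N.*2%:Z) = (p == m.+2) by lia.
have -> : (p == m%:Z - m.*2%:Z) = (p == - m%:Z) by lia.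
have -> : (p == 0%N.*2.+1%:Z - m.+2%:Z) = (p == - m.+1%:Z) by lia.
have -> : (p == m.*2.+1%:Z - m%:Z) = (p == m.+1) by lia.
by ring.
Qed.

(** The expectation of V_e(z) V_{-e}(w) is (1 + e z)(1 - e w) / ((1 - z w)(1 - w/z)), whose partial
    fractions are 1/(1 - w/z) + e z/(1 - z w) when e^2 = 1. *)
Lemma vev_vertex_vertexN (p : int) (m : nat) :
  vev (V e p (V (- e) m vac)) = (p == - m%:Z)%:R + e * (p == m.+1)%:R.
Proof.
have [n nm] := ubnP m; elim: n m p nm => // n IH [|m] p nm.
  by rewrite vertex_vacuum0 vev_vertex_vacuum.
apply: (mulfI (natrS_neq0 pchar0 m)); rewrite vev_newton.
set c := (X in _ = _ * X).
(* The left-hand side is spread over the m + 1 terms of the recursion, so that after adding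
   [cancelling_sum] the identity holds termwise. *)
have -> : m.+1%:R * c = \sum_(r < m.+1) c by rewrite sumr_const card_ord mulr_natl.
rewrite -[RHS]addr0 -[X in _ = _ + X](cancelling_sum p m.+1) -[RHS]big_split.
apply: eq_bigr => r _ /=; have rm := ltn_ord r; rewrite {}/c.
rewrite !IH; try by lia.
rewrite opprK mulrN e2 opprK mul1r.
have -> : (p - (m.+1 - r)%N%:Z == - r%:Z) = (p == m.+1%:Z - r.*2%:Z) by lia.
have -> : (p - (m.+1 - r)%N%:Z == r.+1) = (p == m.+2) by lia.
have -> : (p + (m.+1 - r)%N%:Z == - r%:Z) = (p == - m.+1%:Z) by lia.
have -> : (p + (m.+1 - r)%N%:Z == r.+1) = (p == r.*2.+1%:Z - m.+1%:Z) by lia.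
by ring.
Qed.

End MixedConstants.

Ltac case_indicators :=
  repeat match goal with
  | |- context [@eq_op ?T ?a ?b] => destruct (@eqP T a b); try (exfalso; lia)
  end; rewrite /= ?mulr1n ?mulr0n; try ring.

(* [z^p w^m] (1 - z) (1 - w) (1 - z w) (1 - w / z) *)
Let cB (m : nat) (p : int) : F :=
  match m with
  | 0 => (p == 0)%:R - (p == 1)%:R
  | 1 => (p == 2)%:R - (p == -1)%:R
  | 2 => (p == -1)%:R - (p == 2)%:R
  | 3 => (p == 1)%:R - (p == 0)%:R
  | _ => 0
  end.

Lemma vev_vertexN1_vertexN1 (p : int) (m : nat) : vev (V (-1) p (V (-1) m vac)) = cB m p.
Proof.
have [n nm] := ubnP m; elim: n m p nm => // n IH m p nm.
case: m nm => [|m] nm.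
  by rewrite vertex_vacuum0 vev_vertex_vacuum mulN1r.
apply: (mulfI (natrS_neq0 pchar0 m)); rewrite vev_newton.
have -> : \sum_(r < m.+1) (- (-1 * -1) * (vev (V (-1) (p - (m.+1 - r)%N%:Z) (V (-1) r vac)) +
      vev (V (-1) (p + (m.+1 - r)%N%:Z) (V (-1) r vac))) -
      (- -1) ^+ (m.+1 - r) * vev (V (-1) p (V (-1) r vac))) =
    - \sum_(r < m.+1) (cB r (p - m.+1%:Z + r%:Z) + cB r (p + m.+1%:Z - r%:Z) + cB r p).
  rewrite -sumrN; apply: eq_bigr => r _; have rm := ltn_ord r.
  rewrite !IH; try by lia.
  rewrite [- -1]opprK expr1n.
  have -> : p - (m.+1 - r)%N%:Z = p - m.+1%:Z + r%:Z by lia.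
  have -> : p + (m.+1 - r)%N%:Z = p + m.+1%:Z - r%:Z by lia.
  by ring.
case: m nm => [|[|[|m]]] nm; last first; first last.
- by rewrite !(big_ord_recr, big_ord0) /=; case_indicators.
- by rewrite !(big_ord_recr, big_ord0) /=; case_indicators.
- by rewrite !(big_ord_recr, big_ord0) /=; case_indicators.
(* [zA], [zB], [zC] express that the polynomial defining [cB] vanishes at w = 1/z, w = z and w = 1.
   Its degree in w is 3, so from index 4 on the recursion sums all its coefficients. *)
have zA x : cB 0 (x + 0%N%:Z) + (cB 1 (x + 1%N%:Z) + (cB 2 (x + 2%N%:Z) + cB 3 (x + 3%N%:Z))) = 0.
  by rewrite /=; case_indicators.
have zB x : cB 0 (x - 0%N%:Z) + (cB 1 (x - 1%N%:Z) + (cB 2 (x - 2%N%:Z) + cB 3 (x - 3%N%:Z))) = 0.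
  by rewrite /=; case_indicators.
have zC x : cB 0 x + (cB 1 x + (cB 2 x + cB 3 x)) = 0 by rewrite /=; case_indicators.
have z4 (x : nat -> int) : \sum_(r < m.+4) cB r (x r) =
    cB 0 (x 0%N) + (cB 1 (x 1%N) + (cB 2 (x 2%N) + cB 3 (x 3%N))).
  by rewrite 4!big_ord_recl big1 ?addr0 // => r _.
rewrite [RHS]mulr0; apply/eqP; rewrite oppr_eq0 2!big_split /=; apply/eqP.
rewrite (z4 (fun r => p - m.+4%:Z + r%:Z)) (z4 (fun r => p + m.+4%:Z - r%:Z)) (z4 (fun=> p)).
by rewrite zA zB zC !addr0.
Qed.

Let VVraise e e' p q i v : V e p (V e' q (raise i v)) = raise i (V e p (V e' q v))
  - e *: (V e (p - i.+1%:Z) (V e' q v) + V e (p + i.+1%:Z) (V e' q v))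
  - e' *: (V e p (V e' (q - i.+1%:Z) v) + V e p (V e' (q + i.+1%:Z) v)).
Proof. by rewrite Vraise VD (linN (@vertex_linear F R e e p)) VZ Vraise VD. Qed.

(** The series z V(z) V(w) is antisymmetric: in its expectation the factor z (1 - w/z) is z - w, and
    (1 - z)(1 - w)(1 - z w) is symmetric. *)
Lemma vertexN1_anticomm (a b : int) v :
  V (-1) (a - 1) (V (-1) b v) = - V (-1) (b - 1) (V (-1) a v).
Proof.
apply/eqP; rewrite -subr_eq0 opprK; apply/eqP.
pose D (c : int * int) v := V (-1) (c.1 - 1) (V (-1) c.2 v) + V (-1) (c.2 - 1) (V (-1) c.1 v).
apply: (operator_family_eq0 (D := D) _ _ _ _ (a, b)) => {a b v} [[a b] c u v|[a b]|i [a b]|i [a b] v IH].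
- rewrite /D !vertex_linear !scalerDr; exact: addrACA.
- rewrite /D /= vevD; case: b a => [b|b] [a|a].
  + rewrite !vev_vertexN1_vertexN1; move: a b => [|[|[|[|a]]]] [|[|[|[|b]]]] /=; case_indicators.
  + rewrite (@Vlt0 _ (Negz a)) // V0 vev0 addr0.
    by rewrite vev_vertexN1_vertexN1; move: b => [|[|[|[|b]]]] /=; case_indicators.
  + rewrite (@Vlt0 _ (Negz b)) // V0 vev0 add0r.
    by rewrite vev_vertexN1_vertexN1; move: a => [|[|[|[|a]]]] /=; case_indicators.
  + by rewrite !(@Vlt0 _ (Negz _)) // !V0 vev0 add0r.
- exists (-1 / i.+1%:R), (a - i.+1%:Z, b), (-1 / i.+1%:R), (a, b - i.+1%:Z).
  rewrite /D /= (linD (lower_linear i)) !Vlower lower_vacuum !V0 !add0r !VZ.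
  rewrite [a - _ - 1]addrAC [b - _ - 1]addrAC -!scalerDr; congr (_ *: _).
  by rewrite [X in X + _ = _]addrC addrACA.
- have E x y : V (-1) (x - 1) (V (-1) y v) = - V (-1) (y - 1) (V (-1) x v).
    by apply/eqP; rewrite -subr_eq0 opprK; apply/eqP/(IH (x, y)).
  have ac (x y : int) : x - 1 + y = x + y - 1 by lia.
  rewrite /D /= 2!VVraise (ac a (- i.+1%:Z)) (ac a i.+1%:Z) (ac b (- i.+1%:Z)) (ac b i.+1%:Z).
  rewrite (E a b) (E (a - i.+1%:Z) b) (E (a + i.+1%:Z) b) (E a (b - i.+1%:Z)) (E a (b + i.+1%:Z)).
  rewrite (linN (raise_linear i)) !scaleN1r !opprK -!opprD [X in - X + _]addrAC.
  exact: addNr.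
Qed.

Let clifford_cancel (x y d1 d2 c1 c2 e1 e2 : M) (e : F) :
  x - y - e *: (d1 - c1 + (d2 - c2)) - - e *: (d1 - e1 + (d2 - e2))
  + (y - - e *: (e1 + e2) - e *: (c1 + c2)) - x = 0.
Proof.
rewrite (addrACA d1 (- c1)) (addrACA d1 (- e1)) -(opprD c1 c2) -(opprD e1 e2).
rewrite !scaleNr !opprK !scalerBr; move: (e *: (d1 + d2)) (e *: (c1 + c2)) (e *: (e1 + e2)) => D C E.
rewrite opprB (addrA _ D (- E)) (addrA (x - y) C (- D)) subrK -(addrA (x - y)) -(addrA y) -[E - C]opprB.
by rewrite addrACA subrr addr0 subrK subrr.
Qed.

(** The expectations of V_e(z) V_{-e}(w) and of - (z/w) V_{-e}(w) V_e(z) are expansions of one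
    rational function in powers of w/z and of z/w. Their difference is the formal delta function of
    w/z, with coefficient (1 + e z)(1 - e z)/(1 - z^2) = 1. *)
Lemma vertex_clifford (e : F) (a b : int) v : e * e = 1 ->
  V e a (V (- e) b v) + V (- e) (b + 1) (V e (a - 1) v) = (a + b == 0)%:R *: v.
Proof.
move=> e2; apply/eqP; rewrite -subr_eq0; apply/eqP.
pose D (c : int * int) v := V e c.1 (V (- e) c.2 v) + V (- e) (c.2 + 1) (V e (c.1 - 1) v)
  - (c.1 + c.2 == 0)%:R *: v.
apply: (operator_family_eq0 (D := D) _ _ _ _ (a, b)) => {a b v} [[a b]|[a b]|i [a b]|i [a b] v IH].
- exact: lin_add (lin_add (lin_comp (@vertex_linear _ _ _ _ _) (@vertex_linear _ _ _ _ _))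
    (lin_comp (@vertex_linear _ _ _ _ _) (@vertex_linear _ _ _ _ _))) (lin_opp (lin_scale _ (@lin_id _ _))).
- rewrite /D /= vevD vevN vevZ vev_vacuum mulr1 vevD.
  have first_lt0 : b < 0 -> vev (V e a (V (- e) b vac)) = 0 by move=> b0; rewrite Vlt0 // V0 vev0.
  have second_lt0 : a - 1 < 0 -> vev (V (- e) (b + 1) (V e (a - 1) vac)) = 0.
    by move=> b0; rewrite Vlt0 // V0 vev0.
  have firstE m : b = Posz m -> vev (V e a (V (- e) b vac)) = (a == - m%:Z)%:R + e * (a == m.+1)%:R.
    by move=> ->; apply: vev_vertex_vertexN.
  have e2' : - e * - e = 1 by rewrite mulrNN.
  have secondE m : a - 1 = Posz m ->
      vev (V (- e) (b + 1) (V e (a - 1) vac)) = (b + 1 == - m%:Z)%:R - e * (b + 1 == m.+1)%:R.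
    by move=> ->; have := vev_vertex_vertexN e2' (b + 1) m; rewrite opprK mulNr.
  case: (ltrP b 0) => b0; case: (ltrP (a - 1) 0) => a0.
  + by rewrite first_lt0 // second_lt0 //; case_indicators.
  + by rewrite first_lt0 // (secondE `|(a - 1)%R|%N) //; [case_indicators | lia].
  + by rewrite second_lt0 // (firstE `|b|%N) //; [case_indicators | lia].
  + by rewrite (firstE `|b|%N) ?(secondE `|(a - 1)%R|%N) //; [case_indicators | lia | lia].
- exists (e / i.+1%:R), (a - i.+1%:Z, b), (- (e / i.+1%:R)), (a, b - i.+1%:Z).
  rewrite /D /= !(linD (lower_linear i)) (linN (lower_linear i)) (linZ (lower_linear i)).
  rewrite lower_vacuum scaler0 subr0 !Vlower lower_vacuum !V0 !add0r !VZ mulNr !scaleNr.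
  have -> : a + (b - i.+1%:Z) = a - i.+1%:Z + b by lia.
  have -> : b - i.+1%:Z + 1 = b + 1 - i.+1%:Z by lia.
  rewrite [a - _ - 1]addrAC !scalerBr opprB [in RHS]addrA subrK !scalerDr opprD.
  by rewrite [X in X + _ = _]addrC addrACA.
- have E x y : V e x (V (- e) y v) = (x + y == 0)%:R *: v - V (- e) (y + 1) (V e (x - 1) v).
    by apply/eqP; rewrite -subr_eq0 opprB addrA; apply/eqP/(IH (x, y)).
  rewrite /D /= 2!VVraise (E a b) (E (a - i.+1%:Z) b) (E (a + i.+1%:Z) b).
  rewrite (E a (b - i.+1%:Z)) (E a (b + i.+1%:Z)).
  have -> : a + (b - i.+1%:Z) = a - i.+1%:Z + b by lia.
  have -> : a + (b + i.+1%:Z) = a + i.+1%:Z + b by lia.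
  have -> : b - i.+1%:Z + 1 = b + 1 - i.+1%:Z by lia.
  have -> : b + i.+1%:Z + 1 = b + 1 + i.+1%:Z by lia.
  rewrite [a - i.+1%:Z - 1]addrAC [a + i.+1%:Z - 1]addrAC.
  rewrite (linD (raise_linear i)) (linN (raise_linear i)) (linZ (raise_linear i)).
  exact: clifford_cancel.
Qed.

(** * Commutation of U^* with Gamma *)

Section ShiftRelation.
Variable y : F.
Local Notation Gam := (@shift_exp F R (fun i => y ^+ i.+1)).
Let GL := @shift_exp_linear F R (fun i => y ^+ i.+1).
Let Graise i v : Gam (raise i v) = raise i (Gam v) + y ^+ i.+1 *: Gam v.
Proof. exact: shift_exp_raise. Qed.

(* [w^m] (1 - w) (1 - y w) *)
Let cG (m : nat) : F := match m with 0 => 1 | 1 => - (1 + y) | 2 => y | _ => 0 end.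

Let vev_shift_vertex (m : nat) : vev (Gam (V (-1) m vac)) = cG m.
Proof.
have [n nm] := ubnP m; elim: n m nm => // n IH [|m] nm.
  by rewrite vertex_vacuum0 // shift_exp_vacuum // vev_vacuum.
apply: (mulfI (natrS_neq0 pchar0 m)); rewrite -vevZ -(linZ GL) vertex_newton //.
rewrite (lin_sum GL) (big_morph _ vevD vev0).
have -> : \sum_(r < m.+1) vev (Gam (-1 *: raise (m.+1 - r.+1) (V (-1) r vac)
    - (- -1) ^+ (m.+1 - r) *: V (-1) r vac)) = - \sum_(r < m.+1) (y ^+ (m.+1 - r) + 1) * cG r.
  rewrite -sumrN; apply: eq_bigr => r _; have rm := ltn_ord r.
  rewrite (linD GL) (linN GL) !(linZ GL) Graise vevD vevN !vevZ vevD vevZ vev_raise add0r IH; last by lia.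
  have -> : (m.+1 - r.+1).+1 = (m.+1 - r)%N by lia.
  by rewrite [- -1]opprK expr1n; ring.
case: m nm => [|[|m]] nm.
- by rewrite big_ord1 /=; ring.
- by rewrite !big_ord_recr big_ord0 /=; ring.
rewrite 3!big_ord_recl big1 /= => [|r _]; last by rewrite mulr0.
have -> : (m.+3 - 0 = m.+3)%N by lia.
have -> : (m.+3 - bump 0 0 = m.+2)%N by rewrite /bump; lia.
have -> : (m.+3 - bump 0 (bump 0 0) = m.+1)%N by rewrite /bump; lia.
by rewrite !exprS; ring.
Qed.

Let shift_cancel (t : F) (ra rb a b a1 a2 b1 b2 : M) :
  ra - -1 *: (a1 + a2) + t *: a - y *: (rb - -1 *: (b1 + b2) + t *: b)
  - (ra - y *: rb + t *: (a - y *: b) - -1 *: (a1 - y *: b1 + (a2 - y *: b2))) = 0.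
Proof.
apply/eqP; rewrite subr_eq0 !scaleN1r !opprK; apply/eqP.
rewrite (addrACA a1) -opprD -scalerDr (addrAC (ra - _)).
move: (a1 + a2) (b1 + b2) => A B; rewrite (scalerDr y _ (t *: b)) (scalerDr y rb) !opprD.
rewrite scalerBr (addrACA (ra + A)) (addrACA ra A) [t *: (y *: b)]scalerA mulrC -scalerA.
by [].
Qed.

(** Coefficient form of Gamma(y) V(w) = (1 - y w) V(w) Gamma(y). *)
Lemma vertex_shift j v :
  V (-1) j (Gam v) = Gam (V (-1) j v) + y *: V (-1) (j - 1) (Gam v).
Proof.
pose D (j : int) v := V (-1) j (Gam v) - y *: V (-1) (j - 1) (Gam v) - Gam (V (-1) j v).
suff D0 : D j v = 0.
  by apply/eqP; rewrite -subr_eq0 opprD addrA addrAC; apply/eqP.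
apply: (operator_family_eq0 (D := D) _ _ _ _ j) => {j v} [j|j|i j|i j v IH].
- exact: lin_add (lin_add (lin_comp (@vertex_linear _ _ _ _ _) GL)
   (lin_opp (lin_scale _ (lin_comp (@vertex_linear _ _ _ _ _) GL))))
   (lin_opp (lin_comp GL (@vertex_linear _ _ _ _ _))).
- rewrite /D vevD vevN vevD vevN vevZ shift_exp_vacuum // !vev_vertex_vacuum //.
  case: j => [m|m]; last first.
    by rewrite Vlt0 // (lin0 GL) vev0; case_indicators.
  rewrite vev_shift_vertex; case: m => [|[|[|m]]] /=; case_indicators.
- exists (-1 / i.+1%:R), (j - i.+1%:Z), 0, 0; rewrite scale0r addr0 /D.
  rewrite !(linD (lower_linear i)) !(linN (lower_linear i)) (linZ (lower_linear i)).
  rewrite lower_shift_exp // !Vlower !lower_shift_exp // lower_vacuum (lin0 GL) !V0 !add0r.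
  rewrite (linZ GL) [j - _ - 1]addrAC !scalerBr !scalerA; congr (_ - _ *: _ - _).
  by rewrite mulrC.
- have E x : Gam (V (-1) x v) = V (-1) x (Gam v) - y *: V (-1) (x - 1) (Gam v).
    by apply/esym/eqP; rewrite -subr_eq0; apply/eqP/(IH x).
  have jn (x : int) : j - 1 + x = j + x - 1 by lia.
  rewrite /D Graise !VD !VZ !Vraise (linD GL) (linN GL) (linZ GL) Graise (linD GL) !E.
  rewrite (jn (- i.+1%:Z)) (jn i.+1%:Z) (linD (raise_linear i)) (linN (raise_linear i)).
  rewrite (linZ (raise_linear i)); exact: shift_cancel.
Qed.
End ShiftRelation.

(** Weight at most d, where a_{-n} has weight n: a filtration, so that linear combinations need no
    homogeneity. The coefficient of z^j in V(z) shifts the bound by j, so U^*_{-q} kills every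
    vector of weight below q. *)
Inductive wdeg : nat -> M -> Prop :=
| wdeg_vacuum d : wdeg d vac
| wdeg_raise d i v : wdeg d v -> wdeg (d + i.+1) (raise i v)
| wdeg_lin d a u v : wdeg d u -> wdeg d v -> wdeg d (a *: u + v).

Lemma wdeg0 d : wdeg d 0.
Proof. by rewrite -(addNr vac) -scaleN1r; apply: wdeg_lin; apply: wdeg_vacuum. Qed.

Lemma wdegD d u v : wdeg d u -> wdeg d v -> wdeg d (u + v).
Proof. by rewrite -{2}[u]scale1r; apply: wdeg_lin. Qed.

Lemma wdegZ d a v : wdeg d v -> wdeg d (a *: v).
Proof. by move=> dv; rewrite -[_ *: _]addr0; apply: wdeg_lin (wdeg0 d). Qed.

Lemma wdegW d d' v : (d <= d')%N -> wdeg d v -> wdeg d' v.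
Proof.
move=> dd' dv; elim: dv d' dd' => {d v} [d|d i v dv IH|d a u v du IHu dv IHv] d' dd'.
- exact: wdeg_vacuum.
- have -> : d' = ((d' - i.+1) + i.+1)%N by lia.
  by apply/wdeg_raise/IH; lia.
- by apply: wdeg_lin; [apply: IHu | apply: IHv].
Qed.

Lemma exists_wdeg v : exists d, wdeg d v.
Proof.
elim/fock_ind: v => [|i v [d dv]|a u v [d du] [d' dv]]; first by exists 0%N; apply: wdeg_vacuum.
  by exists (d + i.+1)%N; apply: wdeg_raise.
exists (maxn d d'); apply: wdeg_lin.
  exact: wdegW (leq_maxl _ _) du.
exact: wdegW (leq_maxr _ _) dv.
Qed.

Lemma wdeg_shift_exp (t : nat -> F) d v : wdeg d v -> wdeg d (shift_exp t v).
Proof.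
elim=> {d v} [d|d i v dv IH|d a u v du IHu dv IHv].
- by rewrite shift_exp_vacuum //; apply: wdeg_vacuum.
- rewrite shift_exp_raise //; apply: wdegD; first exact: wdeg_raise.
  by apply/wdegZ/(wdegW _ IH)/leq_addr.
- by rewrite shift_exp_linear; apply: wdeg_lin.
Qed.

Lemma wdeg_vertex_vacuum e (m : nat) : wdeg m (V e m vac).
Proof.
have [n nm] := ubnP m; elim: n m nm => // n IH [|m] nm.
  by rewrite vertex_vacuum0 //; apply: wdeg_vacuum.
rewrite -[V _ _ _]scale1r -(mulVf (natrS_neq0 pchar0 m)) -scalerA vertex_newton //.
apply: wdegZ; apply: (big_ind (wdeg m.+1)) => [|u v|r _]; [exact: wdeg0|exact: wdegD|].
have rm := ltn_ord r; have dr : wdeg r (V e r vac) by apply: IH; lia.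
rewrite -scaleNr; apply: wdegD; apply: wdegZ; last by apply: wdegW dr; lia.
by apply: wdegW (wdeg_raise (m.+1 - r.+1) dr); lia.
Qed.

Lemma wdeg_vertex e d v : wdeg d v -> forall j : int,
  (d%:Z + j < 0 -> V e j v = 0) /\ (forall d' : nat, d%:Z + j <= d' -> wdeg d' (V e j v)).
Proof.
elim=> {d v} [d|d i v dv IH|d a u v du IHu dv IHv] j.
- split=> [dj|d' dj]; first by apply: Vlt0; lia.
  case: j dj => [m|m] dj; last by rewrite Vlt0 //; apply: wdeg0.
  by apply: wdegW (wdeg_vertex_vacuum e m); lia.
- split=> [dj|d' dj]; rewrite Vraise.
    have [h0 _] := IH j; have [h1 _] := IH (j - i.+1%:Z); have [h2 _] := IH (j + i.+1%:Z).
    by rewrite h0 ?h1 ?h2 ?(lin0 (raise_linear i)) ?addr0 ?scaler0 ?subr0 //; lia.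
  rewrite -scaleNr; apply: wdegD; last first.
    by apply/wdegZ/wdegD; [have [_] := IH (j - i.+1%:Z) | have [_] := IH (j + i.+1%:Z)]; apply; lia.
  have [dj0|dj0] := ltrP (d%:Z + j) 0.
    by have [-> // _] := IH j; rewrite (lin0 (raise_linear i)); apply: wdeg0.
  have -> : d' = ((d' - i.+1) + i.+1)%N by lia.
  by apply: wdeg_raise; have [_] := IH j; apply; lia.
- rewrite vertex_linear; have [u0 du'] := IHu j; have [v0 dv'] := IHv j; split.
    by move=> dj; rewrite u0 // v0 // scaler0 addr0.
  by move=> d' dj; apply: wdeg_lin; [apply: du' | apply: dv'].
Qed.

(* U^*_{-q} *)
Definition Ts (q : nat) : M -> M := V (-1) (- q%:Z).

Lemma Ts_linear q : linear (Ts q).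
Proof. exact: vertex_linear. Qed.

Lemma Ts_anticomm p q v : Ts p.+1 (Ts q v) = - Ts q.+1 (Ts p v).
Proof.
have E (n : nat) : - n.+1%:Z = - n%:Z - 1 by lia.
by rewrite /Ts (E p) (E q) vertexN1_anticomm.
Qed.

Lemma Ts_eq0 d q v : wdeg d v -> (d < q)%N -> Ts q v = 0.
Proof. by move=> dv dq; have [h _] := wdeg_vertex (-1) dv (- q%:Z); apply: h; lia. Qed.

Lemma wdeg_Ts d q v : wdeg d v -> wdeg d (Ts q v).
Proof. by move=> dv; have [_ h] := wdeg_vertex (-1) dv (- q%:Z); apply: h; lia. Qed.

Local Notation Gam y := (@shift_exp F R (fun i => y ^+ i.+1)).

Lemma Ts_shift y q v : Ts q (Gam y v) = Gam y (Ts q v) + y *: Ts q.+1 (Gam y v).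
Proof.
have E : - q.+1%:Z = - q%:Z - 1 by lia.
by rewrite /Ts E vertex_shift.
Qed.

(** Iterating [Ts_shift] raises the index until it exceeds the weight of the vector, where U^*_{-q}
    vanishes; the geometric series in y is thereby cut at any [B] above [d]. *)
Lemma Ts_shift_sum y d B q v : wdeg d v -> (d < B)%N ->
  Ts q (Gam y v) = \sum_(q <= a < B) y ^+ (a - q) *: Gam y (Ts a v).
Proof.
move=> dv dB; have [n] := ubnP (B - q); elim: n q => // n IH q nq.
have [Bq|qB] := leqP B q.
  by rewrite big_geq // (Ts_eq0 (wdeg_shift_exp _ dv)) //; apply: leq_trans Bq.
rewrite Ts_shift IH; last by lia.
rewrite (big_ltn qB) subnn expr0 scale1r scaler_sumr; congr (_ + _).
apply: eq_big_nat => a /andP[qa _]; rewrite scalerA -exprS.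
by congr (_ ^+ _ *: _); lia.
Qed.

(** * The functional <0| Gamma(y) *)

Section HalfStep.
Variable y : F.
Hypothesis y_neq0 : y != 0.
Local Notation y' := (y^-1).
Local Notation N := (ropexp (@rannihilation F R 1)).

(** [N] is the annihilation factor of U^*(z), equal to Gamma(z) Gamma(1/z), which is invariant under
    z -> 1/z; hence [c_sym]. The factor 1 - z of U^*(z) then gives [vev_Ts]. *)
Let c (j : int) v : F := vev (N j v).

Let c_linear j a u v : c j (a *: u + v) = a * c j u + c j v.
Proof. by rewrite /c ann_exp_linear // vevD vevZ. Qed.

Let c_raise j i v : c j (raise i v) = c (j - i.+1%:Z) v + c (j + i.+1%:Z) v.
Proof. by rewrite /c ann_exp_raise // vevD vev_raise vevZ vevD mul1r add0r. Qed.

Let c_vacuum j : c j vac = (j == 0)%:R.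
Proof. by rewrite /c ann_exp_vacuum //; case: eqP; rewrite ?vev_vacuum ?vev0. Qed.

Let c_sym j v : c (- j) v = c j v.
Proof.
elim/fock_ind: v j => [|i v IH|a u v IHu IHv] j.
- by rewrite !c_vacuum oppr_eq0.
- by rewrite !c_raise -IH -(IH (j + _)) !opprD !opprK addrC.
- by rewrite !c_linear IHu IHv.
Qed.

Let vev_Ts q v : vev (Ts q v) = c q v - c q.+1 v.
Proof.
suff H j : vev (V (-1) j v) = c j v - c (j - 1) v.
  have E : - q%:Z - 1 = - q.+1%:Z by lia.
  by rewrite /Ts H E !c_sym.
elim/fock_ind: v j => [|i v IH|a u v IHu IHv] j.
- by rewrite vev_vertex_vacuum // !c_vacuum subr_eq0 mulN1r.
- rewrite Vraise vevD vevN vev_raise vevZ vevD !IH !c_raise [j - _ - 1]addrAC [j + _ - 1]addrAC.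
  by ring.
- by rewrite vertex_linear !c_linear vevD vevZ IHu IHv; ring.
Qed.

Let c_eq0 d j v : wdeg d v -> (d < `|j|)%N -> c j v = 0.
Proof.
move=> dv; elim: dv j => {d v} [d|d i v dv IH|d a u v du IHu dv IHv] j dj.
- by rewrite c_vacuum; case: eqP => // j0; lia.
- by rewrite c_raise !IH ?addr0 //; lia.
- by rewrite c_linear IHu // IHv // mulr0 addr0.
Qed.

Let fsupp_c (a : int -> F) v : fsupp (fun j => a j * c j v).
Proof.
have [d dv] := exists_wdeg v; apply: (fsupp_int (B := d)) => j dj.
by rewrite (c_eq0 dv dj) mulr0.
Qed.

Let vev_shift_shift v : vev (Gam y (Gam y' v)) = \sum_(j \in [set: int]) y ^ j * c j v.
Proof.
elim/fock_ind: v => [|i v IH|a u v IHu IHv].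
- rewrite !shift_exp_vacuum // vev_vacuum (fsum_int1 (n := 0)); first by rewrite c_vacuum mulr1.
  by move=> j /negPf j0; rewrite c_vacuum j0 mulr0.
- rewrite shift_exp_raise // (linD (@shift_exp_linear _ _ _)) (linZ (@shift_exp_linear _ _ _)).
  rewrite shift_exp_raise // !vevD vev_raise !vevZ add0r IH.
  have fs (n : int) : fsupp (fun j => y ^ n * (y ^ (j - n) * c (j - n) v)).
    have [A fA] := fsupp_shift n (fsupp_c (fun j => y ^ j) v).
    by exists A => j /fA->; rewrite mulr0.
  have S (n : int) : y ^ n * \sum_(j \in [set: int]) y ^ j * c j v =
      \sum_(j \in [set: int]) y ^ n * (y ^ (j - n) * c (j - n) v).
    rewrite -(fsum_shift _ n); apply: fsum_morph; [exact: mulr0 | exact: mulrDr |].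
    exact: fsupp_shift n (fsupp_c (fun j => y ^ j) v).
  have -> : y' ^+ i.+1 = y ^ (- i.+1%:Z) by rewrite exprVn -exprnN.
  have -> : y ^+ i.+1 = y ^ i.+1%:Z by [].
  rewrite (S i.+1%:Z) (S (- i.+1%:Z)).
  rewrite -fsum_split //; apply: eq_fsbigr => j _.
  by rewrite !mulrA -!expfzDr // c_raise mulrDr !subrKC opprK.
- rewrite !shift_exp_linear vevD vevZ IHu IHv.
  rewrite (fsum_morph (phi := fun x => a * x)) ?mulr0 //; last exact: mulrDr.
  rewrite -fsum_split //; last first.
    by have [A fA] := fsupp_c (fun j => y ^ j) u; exists A => j /fA->; rewrite mulr0.
  by apply: eq_fsbigr => j _; rewrite c_linear; ring.
Qed.

Let fsum_sym (f : int -> F) B : (forall j : int, (B < `|j|)%N -> f j = 0) ->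
  \sum_(j \in [set: int]) f j = f 0 + \sum_(1 <= q < B.+1) (f q%:Z + f (- q%:Z)).
Proof.
elim: B f => [|B IH] f fB.
  by rewrite big_geq // addr0; apply: fsum_int1 => j j0; apply: fB; lia.
pose g (j : int) : F := if `|j|%N == B.+1 then 0 else f j.
have gB j : (B < `|j|)%N -> g j = 0.
  by rewrite /g; case: eqP => // jB1 jB; apply: fB; lia.
have fE j : f j = g j + (`|j|%N == B.+1)%:R * f j.
  by rewrite /g; case: eqP; rewrite ?mul1r ?add0r ?mul0r ?addr0.
have -> : \sum_(j \in [set: int]) f j =
    \sum_(j \in [set: int]) (g j + (`|j|%N == B.+1)%:R * f j).
  by apply: eq_fsbigr => j _; apply: fE.
rewrite fsum_split; last 2 first.
- exact: fsupp_int gB.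
- by apply: (fsupp_int (B := B.+1)) => j /fB->; rewrite mulr0.
rewrite (IH g gB) (fsum_two (V := F^o)) [in RHS]big_nat_recr //= [in RHS]addrA.
have -> : g 0 = f 0 by [].
congr (_ + _); congr (_ + _).
  by apply: eq_big_nat => q /andP[_ qB]; rewrite /g; do 2 (case: eqP => [?|_]; first by lia).
Qed.

Let phi (k : nat) : F := y ^+ k + (0 < k)%N%:R * y ^+ k.-1.
(** The coefficient of <0| U^*_{-q} once Gamma(1/y) has been moved through all U^*_{-k}. By [o0] and
    [o_diff] it is the sum of y^j over -q <= j <= q. *)
Let o (q : nat) : F := \sum_(k < q.+1) phi k * y' ^+ (q - k).

Let oS q : o q.+1 = y' * o q + phi q.+1.
Proof.
rewrite /o big_ord_recr /= subnn expr0 mulr1 mulr_sumr; congr (_ + _).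
apply: eq_bigr => k _; have kq := ltn_ord k.
by rewrite subSn // exprS mulrCA.
Qed.

Let phiS q : phi q.+1 = y ^+ q.+1 + y ^+ q.
Proof. by rewrite /phi mul1r. Qed.

Let o0 : o 0 = 1.
Proof. by rewrite /o big_ord1 /phi subnn !expr0 mul0r addr0 mulr1. Qed.

Let o_diff q : o q.+1 = o q + (y ^+ q.+1 + y' ^+ q.+1).
Proof.
have yy : y' * y = 1 by rewrite mulVf.
(* The closed form of a geometric sum, kept multiplied by 1 - 1/y, which is zero when y = 1. *)
suff H : o q - y' * o q = y ^+ q - y' ^+ q.+1.
  rewrite oS phiS; have -> : y' * o q = o q - (y ^+ q - y' ^+ q.+1) by rewrite -H subKr.
  by move: (y ^+ q.+1) (y' ^+ q.+1) => a b; ring.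
elim: q => [|q IH]; first by rewrite o0 expr1 expr0 mulr1.
have -> : o q.+1 - y' * o q.+1 = y' * (o q - y' * o q) + phi q.+1 - y' * phi q.+1.
  by rewrite oS; move: y' => z; ring.
rewrite IH phiS !exprS; move: y' yy => z zy.
transitivity (y * y ^+ q + y ^+ q - z * y * y ^+ q - z * (z * z ^+ q)); first by ring.
by rewrite zy; ring.
Qed.

(** Summation by parts: the right-hand side is the sum of the o_q (c_q - c_{q+1}), and the
    increments o_q - o_{q-1} = y^q + y^-q are the coefficients of the left-hand side after pairing j
    with -j. *)
Lemma vev_shift_boundary d B v : wdeg d v -> (d < B)%N ->
  vev (Gam y v) = \sum_(k < B)
    (y ^+ k + (0 < k)%N%:R * y ^+ k.-1) * vev (shift_exp (fun i => - y' ^+ i.+1) (Ts k v)).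
Proof.
(* [w] is Gamma(1/y)^-1 v, which turns the left-hand side into the symmetric <0| Gamma(y) Gamma(1/y)
   w. *)
move=> dv dB; pose w := shift_exp (fun i => - y' ^+ i.+1) v.
have dw : wdeg d w by apply: wdeg_shift_exp.
have vw : v = Gam y' w.
  rewrite -{1}(shift_expK pchar0 (fun i => - y' ^+ i.+1) v) /w; congr (shift_exp _ _).
  by apply/funext => i; rewrite opprK.
rewrite [in LHS]vw vev_shift_shift (fsum_sym (B := B.-1)); last first.
  by move=> j jB; rewrite (c_eq0 dw) ?mulr0 //; lia.
have Tk k : vev (shift_exp (fun i => - y' ^+ i.+1) (Ts k v)) =
    \sum_(k <= q < B) y' ^+ (q - k) * (c q w - c q.+1 w).
  rewrite vw (Ts_shift_sum _ _ dw dB) (lin_sum (@shift_exp_linear _ _ _)) (big_morph _ vevD vev0).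
  apply: eq_bigr => q _; rewrite (linZ (@shift_exp_linear _ _ _)) shift_expK // vevZ.
  by rewrite vev_Ts.
under [RHS]eq_bigr do rewrite Tk.
have c_B : c B w = 0 by rewrite (c_eq0 dw) //; lia.
rewrite expr0z mul1r.
case: B dB c_B Tk => // B dB c_B _.
(* Partial summation leaves the boundary term o_n c_{n+1}, which vanishes at the end by [c_B]. *)
have abel n : \sum_(k < n.+1) phi k * (\sum_(k <= q < n.+1) y' ^+ (q - k) * (c q w - c q.+1 w))
    = c 0 w + \sum_(1 <= q < n.+1) (y ^ q%:Z * c q w + y ^ (- q%:Z) * c (- q%:Z) w)
      - o n * c n.+1 w.
  elim: n => [|n IH].
    by rewrite big_ord1 big_nat1 big_geq // /phi !expr0 !mul0r !addr0 o0 !mul1r.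
  have -> : \sum_(k < n.+2) phi k * (\sum_(k <= q < n.+2) y' ^+ (q - k) * (c q w - c q.+1 w)) =
     \sum_(k < n.+1) phi k * (\sum_(k <= q < n.+1) y' ^+ (q - k) * (c q w - c q.+1 w))
      + o n.+1 * (c n.+1 w - c n.+2 w).
    have -> : o n.+1 = \sum_(k < n.+1) phi k * y' ^+ (n.+1 - k) + phi n.+1.
      by rewrite /o big_ord_recr /= subnn expr0 mulr1.
    rewrite big_ord_recr big_nat1 subnn expr0 mul1r [X in _ = _ + X]mulrDl mulr_suml addrA -big_split /=.
    congr (_ + _); apply: eq_bigr => k _; have kn := ltn_ord k.
    by rewrite big_nat_recr /= ?(ltnW kn) // mulrDr mulrA.
  rewrite IH [in RHS]big_nat_recr //= o_diff c_sym.
  have -> : y ^ (- n.+1%:Z) = y' ^+ n.+1 by rewrite exprVn -exprnN.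
  have -> : y ^ n.+1%:Z = y ^+ n.+1 by [].
  by ring.
by rewrite (abel B) c_B mulr0 subr0.
Qed.

End HalfStep.

Lemma lin_vev_comp (f : M -> M) : linear f -> linear (fun v => vev (f v) : F^o).
Proof. by move=> lf; apply: lin_comp (@vev_linear F R) lf. Qed.

(** * Strings of U^* and the two-row step *)

Definition Tstring (s : seq nat) (v : M) : M := foldl (fun w p => Ts p w) v s.

Lemma Tstring_cons p s v : Tstring (p :: s) v = Tstring s (Ts p v).
Proof. by []. Qed.

Lemma Tstring_cat s s' v : Tstring (s ++ s') v = Tstring s' (Tstring s v).
Proof. exact: foldl_cat. Qed.

Lemma Tstring_linear s : linear (Tstring s).
Proof. by elim: s => [|p s IH] a u v //=; rewrite Ts_linear IH. Qed.

Lemma wdeg_Tstring d s v : wdeg d v -> wdeg d (Tstring s v).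
Proof. by elim: s v => //= p s IH v dv; apply/IH/wdeg_Ts. Qed.

Lemma Tstring_alternating (psi : M -> F^o) v : linear psi ->
  alternating (fun s => psi (Tstring s v)).
Proof.
move=> lpsi s a b s'; rewrite !Tstring_cat !Tstring_cons Ts_anticomm //.
by rewrite (linN (Tstring_linear s')) (linN lpsi).
Qed.

Lemma Tstring_bounded (psi : M -> F^o) d B v : linear psi -> wdeg d v -> (d < B)%N ->
  bounded B (fun s => psi (Tstring s v)).
Proof.
move=> lpsi + dB s; elim: s v => //= p s IH v dv /orP[pB|sB].
  by rewrite (Ts_eq0 dv) ?(lin0 (Tstring_linear s)) ?(lin0 lpsi) //; lia.
by apply: IH sB; apply: wdeg_Ts.
Qed.

Lemma Tstring_shift (psi : M -> F^o) y d B mu v : linear psi -> wdeg d v -> (d < B)%N ->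
  psi (Tstring mu (Gam y v)) =
  box_sum B (power_letters y mu) (fun nu => psi (Gam y (Tstring nu v))).
Proof.
move=> lpsi + dB; elim: mu v => //= m mu IH v dv.
rewrite (Ts_shift_sum _ _ dv dB) (lin_sum (Tstring_linear mu)) (lin_sum lpsi).
apply: eq_bigr => a _; rewrite (linZ (Tstring_linear mu)) (linZ lpsi) IH //.
exact: wdeg_Ts.
Qed.

Section Step.
Variable y : F.
Hypothesis y_neq0 : y != 0.

(* An odd row ends with a half-integer: the two terms are the contributions of its possible
   values k and k - 1/2. *)
Definition boundary_weight (k : nat) : F := y ^+ k + (0 < k)%N%:R * y ^+ k.-1.

Definition half_letters (mu : seq nat) : seq (nat * (nat -> F)) :=
  rcons (power_letters y mu) (0%N, boundary_weight).

Lemma vev_Tstring_step d B mu v : sorted geq mu -> wdeg d v -> (d < B)%N ->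
  vev (Tstring mu (Gam y (Gam y^-1 v))) =
  \sum_(s <- strips B (rcons mu 0)) weight (half_letters mu) s *
    \sum_(nu <- strips B s) weight (power_letters y^-1 s) nu * vev (Tstring nu v).
Proof.
move=> mu_sorted dv dB; pose w := Gam y^-1 v.
have dw : wdeg d w by apply: wdeg_shift_exp.
(* <0| Gamma(1/y)^-1, through which [vev_shift_boundary] expresses <0| Gamma(y); the inverse cancels
   once Gamma(1/y) has passed the longer string. *)
pose psi u : F^o := vev (shift_exp (fun i => - y^-1 ^+ i.+1) u).
have lpsi : linear psi by apply: lin_vev_comp; apply: shift_exp_linear.
have lvev : linear (@vev F R : M -> F^o) := @vev_linear F R.
rewrite (Tstring_shift _ _ lvev dw dB).
rewrite (eq_box_sum _ _ (G' := fun s => \sum_(0 <= k < B) boundary_weight k *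
  psi (Tstring (rcons s k) w))); last first.
  move=> s; rewrite (vev_shift_boundary y_neq0 (wdeg_Tstring s dw) dB) big_mkord.
  by apply: eq_bigr => k _; rewrite /Tstring foldl_rcons.
rewrite -(box_sum_rcons _ _ (0%N, boundary_weight) (fun s => psi (Tstring s w))).
(* The cancellation runs over all letters including the new one, which bounds the new entry by the
   last entry of [mu]. *)
rewrite (box_sum_strip_sum pchar0); last 3 first.
- by apply: compatible_power_letters_rcons => // b; rewrite /boundary_weight mul1r.
- exact: Tstring_alternating.
- exact: Tstring_bounded lpsi dw dB.
rewrite strip_sumE map_rcons map_fst_power_letters; apply: eq_big_seq => s s_strip.
congr (_ * _); rewrite (Tstring_shift _ _ lpsi dv dB).
rewrite (eq_box_sum _ _ (G' := fun nu => vev (Tstring nu v) : F)); last first.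
  by move=> nu; rewrite /psi shift_expK.
rewrite (box_sum_strip_sum pchar0).
- by rewrite strip_sumE map_fst_power_letters.
- exact: compatible_power_letters (strips_sorted s_strip).
- exact: Tstring_alternating.
- exact: Tstring_bounded lvev dv dB.
Qed.

End Step.

(** * Orthonormality of bras and kets *)

Section Duality.

(* U_{-p} *)
Definition Us (p : int) : M -> M := V 1 p.

Definition rket (s : seq nat) : M := foldr (fun p v => Us p%:Z v) vac s.

Let Us_linear p : linear (Us p) := @vertex_linear F R 1 1 p.

Lemma Ts_Us (p q : nat) v : Ts q (Us p%:Z v) = (p == q)%:R *: v - Us p.+1%:Z (Ts q.+1 v).
Proof.
have := @vertex_clifford 1 p.+1%:Z (- q.+1%:Z) v (mulr1 _).
have -> : - q.+1%:Z + 1 = - q%:Z by lia.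
have -> : p.+1%:Z - 1 = p%:Z by lia.
have -> : (p.+1%:Z - q.+1%:Z == 0) = (p == q) by lia.
by move=> <-; rewrite addrAC subrr add0r.
Qed.

Inductive rket_span (S : seq nat -> Prop) : M -> Prop :=
| rket_span0 : rket_span S 0
| rket_span_lin s a v : S s -> rket_span S v -> rket_span S (a *: rket s + v).

Lemma rket_spanD S u v : rket_span S u -> rket_span S v -> rket_span S (u + v).
Proof.
elim=> {u} [|s a u Ss uS IH] vS; first by rewrite add0r.
by rewrite -addrA; apply: rket_span_lin => //; apply: IH.
Qed.

Lemma rket_spanZ S a u : rket_span S u -> rket_span S (a *: u).
Proof.
elim=> {u} [|s b u Ss uS IH]; first by rewrite scaler0; apply: rket_span0.
by rewrite scalerDr scalerA; apply: rket_span_lin.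
Qed.

Lemma rket_span_Us (S S' : seq nat -> Prop) (p : nat) u : (forall s, S s -> S' (p :: s)) ->
  rket_span S u -> rket_span S' (Us p%:Z u).
Proof.
move=> SS'; elim=> {u} [|s b u Ss uS IH]; first by rewrite (lin0 (Us_linear _)); apply: rket_span0.
by rewrite Us_linear; apply: (rket_span_lin (s := p :: s)) => //; apply: SS'.
Qed.

Lemma Ts_vacuum q : (0 < q)%N -> Ts q vac = 0.
Proof. by move=> q0; apply: (Ts_eq0 (wdeg_vacuum 0)). Qed.

(** By [Ts_Us], U^*_{-q} either cancels one factor of the ket or reaches the vacuum with a larger
    index and kills it; the excluded case is U^*_0 on the vacuum. *)
Lemma Ts_rket_size (s : seq nat) q : ((0 < size s) || (0 < q))%N ->
  rket_span (fun s' => (size s').+1 = size s) (Ts q (rket s)).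
Proof.
elim: s q => [|p s IH] q /=; first by move=> q0; rewrite Ts_vacuum //; apply: rket_span0.
move=> _; rewrite Ts_Us; apply: rket_spanD.
  by rewrite -[_ *: _]addr0; apply: rket_span_lin => //; apply: rket_span0.
rewrite -scaleN1r; apply: rket_spanZ.
apply: (rket_span_Us _ (IH q.+1 _)); last by rewrite orbT.
by move=> s' /= ->.
Qed.

(** All entries of [q] are below [p], so none contracts with the leading factor. Each passes it,
    raising its index, and removes one of the other factors; the string is long enough to exhaust
    these, and its next operator meets the vacuum with positive index. *)
Lemma Tstring_rket_lt q (p : nat) s : size q = (size s).+1 -> path geq p.-1 q -> (0 < p)%N ->
  Tstring q (rket (p :: s)) = 0.
Proof.
elim: q p s => // q0 q IH p s [sq]; rewrite [path _ _ _]/= => /andP[q0p q_path] p0.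
rewrite Tstring_cons Ts_Us.
have -> : (p == q0) = false by move: q0p; rewrite /geq /=; lia.
rewrite scale0r add0r (linN (Tstring_linear q)); apply/eqP; rewrite oppr_eq0; apply/eqP.
have := @Ts_rket_size s q0.+1; rewrite orbT => /(_ isT).
move: (Ts _ _) => u; elim=> {u} [|s' a u ss' uS IHu].
  by rewrite (lin0 (Us_linear _)) (lin0 (Tstring_linear q)).
rewrite Us_linear Tstring_linear IHu addr0 -/(rket (p.+1 :: s')) IH ?scaler0 //; first by rewrite sq.
apply: path_le q_path; last by move: q0p; rewrite /geq /=; lia.
by move=> x y z; rewrite /geq /=; lia.
Qed.

(** No contraction occurs: the operator passes every factor, its index growing, and kills the
    vacuum. *)
Lemma Ts_rket_gt q s : (s != [::]) || (0 < q)%N -> all (fun p => (p < q)%N) s ->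
  Ts q (rket s) = 0.
Proof.
elim: s q => [|p s IH] q /=; first by move=> q0 _; apply: Ts_vacuum.
move=> _ /andP[pq sq]; rewrite Ts_Us (ltn_eqF pq) scale0r add0r IH ?orbT //.
  by rewrite (lin0 (Us_linear _)) oppr0.
by apply: sub_all sq => x /ltnW; rewrite ltnS.
Qed.

(** Comparison of the first entries: [Tstring_rket_lt] settles m < p and [Ts_rket_gt] settles m > p.
    For m = p the delta of [Ts_Us] removes both, and the other term vanishes because m + 1 exceeds
    all remaining entries. *)
Lemma vev_Tstring_rket mu la : size mu = size la -> sorted geq mu -> sorted geq la ->
  vev (Tstring mu (rket la)) = (mu == la)%:R.
Proof.
elim: mu la => [|m mu IH] [|p la] // => [_ _ _|[sz] mu_path la_path]; first exact: vev_vacuum.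
have [mp|pm|mp] := ltngtP m p.
- rewrite Tstring_rket_lt; last 3 first.
  + by rewrite /= sz.
  + by rewrite /=; apply/andP; split; [rewrite /geq /=; lia | exact: mu_path].
  + by lia.
  have -> : (m :: mu == p :: la) = false by apply/negbTE; rewrite eqseq_cons negb_and ltn_eqF.
  exact: vev0.
- rewrite Tstring_cons Ts_rket_gt //; last first.
    rewrite /= pm /=; apply/allP => x xla.
    have /allP /(_ x xla) : all (geq p) la.
      by apply: order_path_min la_path => a b c; rewrite /geq /=; lia.
    by rewrite /geq /=; lia.
  have -> : (m :: mu == p :: la) = false by apply/negbTE; rewrite eqseq_cons negb_and gtn_eqF.
  by rewrite (lin0 (Tstring_linear mu)) vev0.
- rewrite Tstring_cons Ts_Us mp eqxx scale1r Ts_rket_gt ?orbT //; last first.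
    apply/allP => x xla; have /allP /(_ x xla) : all (geq p) la.
      by apply: order_path_min la_path => a b c; rewrite /geq /=; lia.
    by rewrite /geq /=; lia.
  rewrite (lin0 (Us_linear _)) subr0 IH ?(path_sorted mu_path) ?(path_sorted la_path) //.
  by rewrite eqseq_cons eqxx.
Qed.

End Duality.

End VertexRelations.

(** * Branching of the skew characters *)

Section SkewCharacter.
Variable F : fieldType.
Hypothesis pchar0 : [pchar F] =i pred0.
Local Notation R := (malg_fock_rep pchar0).

Transparent opiter vertex.

Let creationE c : opscale c (@creation_ser F) = @rcreation F R c.
Proof.
apply/funext => j; apply/funext => v; rewrite /opscale /creation_ser /rcreation.
case: j => [[|j]|j]; [exact: scaler0 | | exact: scaler0].
by rewrite -NegzE.
Qed.

Let annihilationE c : opscale c (@annihilation_ser F) = @rannihilation F R c.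
Proof.
apply/funext => j; apply/funext => v; rewrite /opscale /annihilation_ser /rannihilation.
case: eqP => [_|/eqP j0]; first exact: scaler0.
have -> : `|j| = (`|j|%N.-1.+1)%:Z by lia.
by congr (c *: _); rewrite [heis _ _]/= [LHS]scalerA -pmulrn mulVf ?scale1r ?natrS_neq0.
Qed.

Let opscale1 (A : opser F) : opscale 1 A = A.
Proof. by apply/funext => j; apply/funext => v; rewrite /opscale scale1r. Qed.

Let opexpE (A : opser F) : opexp A = ropexp (A : ropser R).
Proof. by []. Qed.

Let UstarE : @Ustar_ser F = @vertex F R (-1) (-1).
Proof. by rewrite /Ustar_ser /vertex opprK -(annihilationE 1) (opscale1 (@annihilation_ser F)) -(creationE (-1)). Qed.

Let UE : @U_ser F = @vertex F R 1 1.
Proof.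
rewrite /U_ser /vertex -(annihilationE (-1)) -(creationE 1) (opscale1 (@creation_ser F)).
rewrite -(opexpE (@creation_ser F)).
rewrite -(opexpE (opscale (-1) (@annihilation_ser F))).
reflexivity.
Qed.

Let GammaE (y : F) : Gamma y = @shift_exp F R (fun i => y ^+ i.+1).
Proof.
suff E : Gamma_exponent y = @shift_exponent F R (fun i => y ^+ i.+1).
  by apply/funext => v; rewrite /Gamma E.
apply/funext => v; rewrite /Gamma_exponent (reindex_fsbig S [set: nat]).
  by apply: eq_fsbigr => i _; rewrite [heis _ _]/= [LHS]scalerA divfK ?natrS_neq0.
by split=> [//|i j _ _ []//|[//|i] _]; exists i.
Qed.
Opaque opiter vertex.

Lemma braE (mu : seq nat) (v : fock F) : bra mu v = @vev F R (@Tstring F R mu v).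
Proof. by rewrite /bra /Ustar UstarE. Qed.

Lemma ketE (la : seq nat) : ket F la = rket R la.
Proof.
elim: la => [|p la IH]; first by [].
transitivity (@U_ser F (- - p%:Z) (ket F la)); first by [].
by rewrite opprK IH UE.
Qed.

Lemma Gamma_pm0 (x : 'I_0 -> F) v : Gamma_pm x v = v.
Proof. by rewrite /Gamma_pm enum_ord0. Qed.

Lemma Gamma_pmS N (x : 'I_N.+1 -> F) v :
  Gamma_pm x v = Gamma (x ord0) (Gamma (x ord0)^-1 (Gamma_pm (fun i => x (lift ord0 i)) v)).
Proof. by rewrite /Gamma_pm enum_ordSl /= foldr_map. Qed.

Lemma skew_so0 (mu la : seq nat) (x : 'I_0 -> F) : size mu = size la ->
  sorted geq mu -> sorted geq la -> skew_so mu la x = (mu == la)%:R.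
Proof. by move=> *; rewrite /skew_so Gamma_pm0 braE ketE vev_Tstring_rket. Qed.

(** The threshold depends on the weight of the vector; stating the formula for all larger [B] leaves
    room for the bound required by the enumeration of patterns. *)
Lemma skew_soS N (mu la : seq nat) (x : 'I_N.+1 -> F) : sorted geq mu -> x ord0 != 0 ->
  exists B0, forall B, (B0 <= B)%N -> skew_so mu la x =
  \sum_(s <- strips B (rcons mu 0)) weight (half_letters (x ord0) mu) s *
    \sum_(nu <- strips B s) weight (power_letters (x ord0)^-1 s) nu *
      skew_so nu la (fun i => x (lift ord0 i)).
Proof.
move=> mu_sorted x0; rewrite /skew_so Gamma_pmS; set v := Gamma_pm _ _.
have [d dv] := @exists_wdeg F R v; exists d.+1 => B dB.
rewrite braE (GammaE (x ord0)) (GammaE (x ord0)^-1).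
apply: (etrans (vev_Tstring_step pchar0 x0 mu_sorted dv dB)).
apply: eq_bigr => s _; apply: (congr1 ( *%R _)); apply: eq_bigr => nu _.
by apply: (congr1 ( *%R _)); rewrite braE.
Qed.

End SkewCharacter.

(** * Patterns *)

Section PatternRecursion.
Implicit Types (s mu nu la : seq nat) (r : seq rat) (z : seq (seq rat)).

Lemma stripsP b ms s : s \in strips b ms <-> size s = size ms /\
  forall j, (j < size ms)%N -> (nth 0 ms j <= nth 0 s j)%N /\
    (nth 0 s j < if j is j'.+1 then (nth 0 ms j').+1 else b)%N.
Proof.
elim: ms b s => [|m ms IH] b s /=.
  by rewrite inE; split=> [/eqP->//|[/size0nil->]].
split=> [/allpairsPdep[a [s' [ab s's ->]]]|].
  move: ab; rewrite mem_index_iota => /andP[ma ab].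
  have [sz H] := (IH m.+1 s').1 s's; split=> [|j]; first by rewrite /= sz.
  case: j => [|j] // jm; have [h1 h2] := H j jm; split=> //.
  by case: j jm h1 h2.
case: s => [[//]|a s [[sz] H]]; apply/allpairsPdep; exists a, s; split=> //.
  by have [//|h1 h2] := H 0%N; rewrite mem_index_iota h1 h2.
apply/(IH m.+1 s); split=> // j jm; have [//|h1 h2] := H j.+1; split=> //.
by case: j jm h1 h2.
Qed.

Definition qrow s : seq rat := [seq p%:R | p <- s].

Lemma nth_qrow s i : nth 0 (qrow s) i = (nth 0 s i)%:R.
Proof.
have [si|si] := leqP (size s) i; last by rewrite (nth_map 0).
by rewrite !nth_default ?size_map.
Qed.

Lemma qrow_inj : injective qrow.
Proof. by apply: inj_map => p q /eqP; rewrite eqr_nat => /eqP. Qed.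

Lemma sorted_qrow s : sorted >=%R (qrow s) = sorted geq s.
Proof. by rewrite sorted_map; apply: eq_sorted => p q /=; rewrite ler_nat. Qed.

Lemma qrow_ge0 s : {in qrow s, forall t, 0 <= t}.
Proof. by move=> t /mapP[p _ ->]. Qed.

Lemma qrowP r : {in r, forall t, 0 <= t} -> (forall i, (i < size r)%N -> nth 0 r i \is a Num.int) ->
  exists s, r = qrow s.
Proof.
move=> r0 rint; exists [seq Num.truncn t | t <- r].
rewrite /qrow -map_comp map_id_in // => t tr /=; rewrite truncnK //.
have := rint (index t r); rewrite index_mem tr nth_index // => /(_ isT).
by rewrite natrEint r0 // andbT.
Qed.

(** The conditions linking the odd row [r] to its integer neighbours [mu] and [nu]; positions count
    from 0 here and from 1 in [zent]. *)
Record row_step l mu r nu : Prop := RowStep {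
  step_size : size r = l.+1;
  step_sorted : sorted >=%R r;
  step_ge0 : {in r, forall t, 0 <= t};
  step_below : forall i, (i < l)%N -> nth 0 r i.+1 <= (nth 0 mu i)%:R <= nth 0 r i;
  step_above : forall i, (i < l)%N -> (nth 0 nu i.+1)%:R <= nth 0 r i <= (nth 0 nu i)%:R;
  step_half : [/\ 2 * nth 0 r l \is a Num.int, 0 <= nth 0 r l &
    nth 0 r l <= Num.min (nth 0 nu l)%:R (nth 0 mu l.-1)%:R];
  step_int : forall i, (i < l)%N -> nth 0 r i \is a Num.int
}.

Lemma so_pattern0 l mu la z : size mu = l -> sorted geq mu ->
  so_pattern l 0 mu la z <-> z = [:: qrow mu] /\ mu = la.
Proof.
move=> sz mu_sorted; split=> [[sz1 _ first0 last0 _ _ _ _ _]|[-> <-]].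
  case: z sz1 first0 last0 => [|r [|? ?]] //= _; rewrite /zrow /= => -> /qrow_inj->.
  by [].
split=> //.
- by case=> // _; rewrite /zrow /= size_map sz addn0.
- by case=> // _; rewrite /zrow /= -/(qrow mu) sorted_qrow.
- by case=> // _; apply: qrow_ge0.
- by case=> [|i] //= /andP[]; rewrite leqn0.
- case=> // j _ _ _; rewrite /zent /zrow /= -/(qrow mu) nth_qrow.
  exact: rpred_nat.
Qed.

(** Removing the first two rows leaves a pattern with l + 1 in place of l, since the half-integral
    positions satisfy l + (i + 1) = (l + 1) + i. *)
Lemma so_patternS l N mu la z : (0 < l)%N -> size mu = l -> sorted geq mu ->
  so_pattern l N.+1 mu la z <-> exists r nu z', [/\ z = [:: qrow mu, r & z'],
    size nu = l.+1, sorted geq nu, row_step l mu r nu & so_pattern l.+1 N nu la z'].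
Proof.
move=> l0 szmu mu_sorted; split.
  case: z => [|r0 [|r z']] [sz rsz first0 last0 rsorted rge0 inter half ints] //.
  have r0E : r0 = qrow mu by [].
  have [nu nuE] : exists nu, zrow z' 0 = qrow nu.
    (* Row 2 is integral because the exceptional entries lie in odd rows. *)
    apply: qrowP; first exact: (rge0 2%N isT).
    move=> i isz; apply: (ints 2%N i.+1) => //.
      by have := rsz 2%N isT; rewrite /zrow /= in isz * => <-.
    by case=> i' [_ e _]; move: e; case: i' => // i'; rewrite doubleS; lia.
  have nusz : size nu = l.+1.
    by have := rsz 2%N isT; rewrite -[zrow _ 2]/(zrow z' 0) nuE size_map addn1.
  have nusorted : sorted geq nu.
    by have := rsorted 2%N isT; rewrite -[zrow _ 2]/(zrow z' 0) nuE sorted_qrow.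
  exists r, nu, z'; split=> //; first by rewrite r0E.
    split.
    - by have := rsz 1%N isT; rewrite addn1.
    - exact: (rsorted 1%N).
    - exact: (rge0 1%N).
    - move=> i il; have /= := inter 0%N i.+2 isT; rewrite addn1 ltnS il => /(_ isT).
      by rewrite /zent /zrow /= r0E nth_qrow.
    - move=> i il; have /= := inter 1%N i.+2 isT; rewrite addn1 ltnS il => /(_ isT).
      by rewrite /zent -[zrow _ 2]/(zrow z' 0) nuE /zrow /= !nth_qrow.
    - have := half 1%N isT; rewrite /zent -[zrow _ 1.*2]/(zrow z' 0) nuE /zrow /= addn1 /=.
      by rewrite r0E !nth_qrow.
    - move=> i il; apply: (ints 1%N i.+1) => //; first by rewrite /= addn1 ltnS ltnW.
      by case=> i' [/andP[i0 _] e e']; move: e e'; case: i' i0 => // i' _; rewrite doubleS; lia.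
  split.
  - by move: sz; rewrite /= doubleS; lia.
  - by move=> k kN; have := rsz k.+2; rewrite doubleS /= => /(_ kN) ->; lia.
  - exact: nuE.
  - by move: last0; rewrite doubleS.
  - by move=> k kN; apply: (rsorted k.+2); rewrite doubleS.
  - by move=> k kN; apply: (rge0 k.+2); rewrite doubleS.
  - move=> k j kN jl; apply: (inter k.+2 j); first by rewrite doubleS.
    by move: jl => /=; lia.
  - case=> // i iN; have := half i.+2 iN.
    by rewrite !doubleS /= addnS addSn.
  - move=> k j kN jl notex; apply: (ints k.+2 j); first by rewrite doubleS.
      by move: jl => /=; lia.
    case=> -[|[|i]] [/andP[i0 iN] e e'] //; apply: notex; exists i.+1.
    by split; [lia | move: e; rewrite !doubleS /=; lia | lia].
case=> r [nu [z' [-> nusz nusorted [rsz rsorted rge0 below above half rint]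
  [sz' rsz' first' last' sorted' ge0' inter' half' ints']]]].
have zr0 : zrow z' 0 = qrow nu by [].
split.
- by rewrite /= sz' doubleS.
- case=> [|[|k]] kN; rewrite /zrow /=.
  + by rewrite size_map szmu addn0.
  + by rewrite rsz addn1.
  + by rewrite [size _]rsz' ?addnS ?addSn //; move: kN; rewrite doubleS.
- by [].
- by rewrite doubleS.
- case=> [|[|k]] kN; [by rewrite -/(qrow mu) sorted_qrow | by [] |].
  by apply: (sorted' k); move: kN; rewrite doubleS.
- case=> [|[|k]] kN; [exact: qrow_ge0 | by [] |].
  by apply: (ge0' k); move: kN; rewrite doubleS.
- case=> [|[|k]] j kN jl.
  + case: j jl => [|[|j]] //= jl; rewrite /zent /zrow /= -/(qrow mu) nth_qrow.
    by apply: below; lia.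
  + case: j jl => [|[|j]] //= jl; rewrite /zent -[zrow _ 2]/(zrow z' 0) zr0 /zrow /= !nth_qrow.
    by apply: above; lia.
  + by apply: (inter' k j); [move: kN; rewrite doubleS | move: jl => /=; lia].
- case=> [|[|i]] // iN.
    by rewrite /zent -[zrow _ 1.*2]/(zrow z' 0) zr0 /zrow /= addn1 /= -/(qrow mu) !nth_qrow.
  have := half' i.+1 iN; have -> : (l.+1 + i.+1 = l + i.+2)%N by lia.
  by rewrite !doubleS.
- case=> [|[|k]] j kN jl notex.
  + by rewrite /zent /zrow /= -/(qrow mu) nth_qrow; apply: rpred_nat.
  + case: j jl notex => // j /andP[_ jl] notex; apply: rint.
    rewrite /= addn1 ltnS leq_eqVlt in jl; case/orP: jl => // /eqP jl.
    by case: notex; exists 1%N; split=> //; rewrite jl addn1.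
  + apply: (ints' k j); [by move: kN; rewrite doubleS | by move: jl => /=; lia |].
    case=> -[|i] [// /andP[i0 iN] e e']; apply: notex; exists i.+2.
    by split; [lia | rewrite !doubleS /= e doubleS | lia].
Qed.

(** An odd row is encoded by the row [s] of its ceilings and a bit telling whether the last entry
    lies 1/2 below its ceiling. *)
Definition half_row s (h : bool) : seq rat :=
  mkseq (fun j => (nth 0%N s j)%:R - (h && (j.+1 == size s))%:R / 2) (size s).

(** A last entry 0 cannot be lowered, entries being nonnegative; this matches the single term of
    [boundary_weight] at 0. *)
Definition halves s : seq bool := if last 0%N s == 0%N then [:: false] else [:: false; true].

Lemma mem_halves s h : (h \in halves s) = (h ==> (0 < last 0%N s)%N).
Proof. by rewrite /halves lt0n; case: eqP => _; case: h. Qed.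

(** A half-integer obeys the same integer upper bounds as its ceiling, so the minimum condition on
    the last entry of an odd row becomes a strip condition on the ceilings. *)
Lemma ler_sub_half (c m : nat) (h : bool) : (c%:R - h%:R / 2 <= m%:R :> rat) = (c <= m)%N.
Proof.
case: leqP => cm.
  have : c%:R <= m%:R :> rat by rewrite ler_nat.
  by case: h => /=; lra.
have : m%:R + 1 <= c%:R :> rat by rewrite natr1 ler_nat.
by move=> ?; apply/negbTE; rewrite -ltNge; case: h => /=; lra.
Qed.

Lemma nth_half_row l s h j : size s = l.+1 -> (j < l)%N -> nth 0 (half_row s h) j = (nth 0%N s j)%:R.
Proof.
move=> sz jl; rewrite nth_mkseq ?sz 1?ltnW // eqSS (ltn_eqF jl) andbF mul0r subr0 //.
Qed.

Lemma nth_half_row_last l s h : size s = l.+1 ->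
  nth 0 (half_row s h) l = (nth 0%N s l)%:R - h%:R / 2.
Proof. by move=> sz; rewrite nth_mkseq ?sz // eqxx andbT. Qed.

Lemma nth_last_row l s : size s = l.+1 -> last 0%N s = nth 0%N s l.
Proof. by move=> sz; rewrite -nth_last sz. Qed.

Lemma row_step_half_row l b mu nu s h : (0 < l)%N -> size mu = l -> sorted geq nu ->
  s \in strips b (rcons mu 0%N) -> h \in halves s -> nu \in strips b s ->
  row_step l mu (half_row s h) nu.
Proof.
move=> l0 szmu nusorted /stripsP[sz below] hs /stripsP[sznu above].
rewrite size_rcons szmu in sz; rewrite sz in above; rewrite size_rcons szmu in below.
have {}hs : h -> (0 < nth 0 s l)%N by move: hs; rewrite mem_halves (nth_last_row sz) => /implyP.
have row_le j m : (j < l.+1)%N -> (nth 0 s j <= m)%N -> nth 0 (half_row s h) j <= m%:R.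
  rewrite ltnS leq_eqVlt => /orP[/eqP->|jl] jm; last by rewrite (nth_half_row h sz jl) ler_nat.
  by rewrite (nth_half_row_last h sz) ler_sub_half.
have muE i : (i < l)%N -> nth 0 (rcons mu 0%N) i = nth 0%N mu i.
  by move=> il; rewrite nth_rcons szmu il.
have belowE i : (i < l)%N -> nth 0 (half_row s h) i.+1 <= (nth 0%N mu i)%:R <= nth 0 (half_row s h) i.
  move=> il; apply/andP; split.
    by apply: row_le => //; have [//|_] := below i.+1; rewrite (muE i il) ltnS.
  by rewrite (nth_half_row h sz il) ler_nat -(muE i il); have [] := below i (ltnW il).
split=> //.
- by rewrite size_mkseq.
- apply/(sortedP 0) => i; rewrite size_mkseq sz ltnS => il.
  by have /andP[le1 le2] := belowE i il; apply: le_trans le2.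
- move=> t /(nthP 0)[j]; rewrite size_mkseq sz ltnS leq_eqVlt => /orP[/eqP->|jl] <-; last first.
    by rewrite (nth_half_row h sz jl).
  rewrite (nth_half_row_last h sz); case: h hs {row_le belowE} => /= [/(_ isT)|_]; last by rewrite mul0r subr0.
  by rewrite -(ler_nat rat); lra.
- move=> i il; rewrite (nth_half_row h sz il) !ler_nat.
  have [//|_] := above i.+1; rewrite ltnS => ->.
  by have [-> _] := above i (ltnW il).
- rewrite (nth_half_row_last h sz) le_min !ler_sub_half; split.
  + by rewrite mulrBr mulrCA divff // mulr1 rpredB ?rpredM ?rpred_nat.
  + case: h hs {row_le belowE} => /= [/(_ isT)|_]; last by rewrite mul0r subr0.
    by rewrite -(ler_nat rat); lra.
  + have [//|-> _] := above l; rewrite /=.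
    have [//|_] := below l; case: (l) l0 (muE) => // l' _ muE'.
    by rewrite muE'.
- by move=> i il; rewrite (nth_half_row h sz il) rpred_nat.
Qed.

Lemma half_row_row_step l b mu nu r : (0 < l)%N -> size mu = l -> size nu = l.+1 ->
  (nth 0 nu 0 < b)%N -> row_step l mu r nu ->
  exists s h, [/\ s \in strips b (rcons mu 0%N), h \in halves s, r = half_row s h &
                  nu \in strips b s].
Proof.
move=> l0 szmu sznu nub [rsz rsorted rge0 below above [half1 half2 half3] rint].
(* The last entry is n/2; its ceiling is [uphalf n] and the bit is the parity of n. *)
have [n nE] : exists n : nat, 2 * nth 0 r l = n%:R.
  by apply/natrP; rewrite natrEint half1 mulr_ge0.
pose s := rcons (mkseq (fun i => Num.truncn (nth 0 r i)) l) (uphalf n).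
have sz : size s = l.+1 by rewrite size_rcons size_mkseq.
have sE i : (i < l)%N -> nth 0 r i = (nth 0%N s i)%:R.
  move=> il; rewrite nth_rcons size_mkseq il nth_mkseq // truncnK //.
  by rewrite natrEint rint // rge0 // mem_nth // rsz ltnW.
have sl : nth 0%N s l = uphalf n by rewrite nth_rcons size_mkseq ltnn eqxx.
have rl : nth 0 r l = (nth 0%N s l)%:R - (odd n)%:R / 2.
  have : (uphalf n)%:R * 2 = n%:R + (odd n)%:R :> rat.
    rewrite -natrM -natrD; congr (_%:R); rewrite uphalf_half.
    by have := odd_double_half n; case: (odd n) => /=; lia.
  by rewrite sl; lra.
have rE : r = half_row s (odd n).
  apply: (@eq_from_nth _ 0); first by rewrite size_mkseq sz.
  rewrite rsz => i; rewrite ltnS leq_eqVlt => /orP[/eqP->|il].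
    by rewrite (nth_half_row_last _ sz).
  by rewrite (nth_half_row _ sz il) sE.
move: half3; rewrite rl le_min !ler_sub_half => /andP[lenu lemu].
exists s, (odd n); split=> //.
- apply/stripsP; rewrite size_rcons szmu; split=> // j; rewrite ltnS leq_eqVlt => /orP[/eqP->|jl].
    rewrite nth_rcons szmu ltnn eqxx; split=> //.
    by case: (l) l0 lemu szmu => // l' _ lemu szmu; rewrite nth_rcons szmu ltnSn ltnS.
  have := below j jl; rewrite nth_rcons szmu jl (sE j jl) ler_nat => /andP[_ ->]; split=> //.
  case: j jl => [|j] jl.
    by have := above 0%N jl; rewrite (sE _ jl) !ler_nat => /andP[_ /leq_ltn_trans]; apply.
  by have := below j (ltnW jl); rewrite (sE _ jl) nth_rcons szmu (ltnW jl) ler_nat ltnS => /andP[].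
- rewrite mem_halves (nth_last_row sz) sl; apply/implyP.
  by case: (n) => // n'.
- apply/stripsP; rewrite sz; split=> // j; rewrite ltnS leq_eqVlt => /orP[/eqP->|jl].
    split=> //; case: (l) l0 above sE => // l' _ above sE.
    by have := above l' (ltnSn l'); rewrite (sE _ (ltnSn l')) !ler_nat ltnS => /andP[].
  have := above j jl; rewrite (sE j jl) !ler_nat => /andP[_ ->]; split=> //.
  case: j jl => // j jl.
  by have := above j (ltnW jl); rewrite (sE _ (ltnW jl)) !ler_nat ltnS => /andP[].
Qed.

End PatternRecursion.

(** * Enumeration of the patterns and their weights *)

Section PatternSum.
Implicit Types (s mu nu la : seq nat) (z : seq (seq rat)).

Lemma half_row_inj l s s' h h' : size s = l.+1 -> size s' = l.+1 ->
  half_row s h = half_row s' h' -> s = s' /\ h = h'.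
Proof.
move=> sz sz' e.
have E j : (j < l)%N -> nth 0%N s j = nth 0%N s' j.
  move=> jl; have := congr1 (fun r => nth 0 r j) e.
  by rewrite /= (nth_half_row _ sz jl) (nth_half_row _ sz' jl) => /eqP; rewrite eqr_nat => /eqP.
have := congr1 (fun r => nth 0 r l) e.
rewrite /= (nth_half_row_last _ sz) (nth_half_row_last _ sz') => el.
have [sl hh] : nth 0%N s l = nth 0%N s' l /\ h = h'.
  have /eqP : ((nth 0%N s l).*2 + h')%:R = ((nth 0%N s' l).*2 + h)%:R :> rat.
    by rewrite !natrD -!mul2n !natrM; lra.
  by rewrite eqr_nat; case: (h) (h') => [] [] /=; lia.
split=> //; apply: (@eq_from_nth _ 0%N) => [|j]; first by rewrite sz.
by rewrite sz ltnS leq_eqVlt => /orP[/eqP->|/E].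
Qed.

Lemma strips_uniq b ms : uniq (strips b ms).
Proof.
elim: ms b => //= m ms IH b; apply: allpairs_uniq_dep => //; first exact: iota_uniq.
by move=> [a s] [a' s'] _ _ /= [-> ->].
Qed.

Definition row_pairs b mu : seq (seq nat * bool * seq nat) :=
  [seq (q, nu) | q <- [seq (s, h) | s <- strips b (rcons mu 0%N), h <- halves s],
                 nu <- strips b q.1].

Fixpoint patterns b N mu la : seq (seq (seq rat)) :=
  if N is N'.+1 then
    [seq [:: qrow mu, half_row p.1.1 p.1.2 & z] | p <- row_pairs b mu, z <- patterns b N' p.2 la]
  else if mu == la then [:: [:: qrow mu]] else [::].

Lemma row_pairsP b mu s h nu : reflect
  [/\ s \in strips b (rcons mu 0%N), h \in halves s & nu \in strips b s]
  ((s, h, nu) \in row_pairs b mu).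
Proof.
apply: (iffP idP) => [/allpairsPdep[q [nu' [/allpairsPdep[s' [h' [s's hh' ->]]] nunu' /=]]]|[ss hh nn]].
  by case=> -> -> ->.
apply/allpairsPdep; exists (s, h), nu; split=> //.
by apply/allpairsPdep; exists s, h.
Qed.

Lemma row_pairs_uniq b mu : uniq (row_pairs b mu).
Proof.
apply: allpairs_uniq_dep => [|q _|[q nu] [q' nu'] _ _ /= [-> ->] //].
  apply: allpairs_uniq_dep => [|s _|[s h] [s' h'] _ _ /= [-> ->] //].
    exact: strips_uniq.
  by rewrite /halves; case: ifP.
exact: strips_uniq.
Qed.

Lemma patterns_head b N mu la z : z \in patterns b N mu la -> zrow z 0 = qrow mu.
Proof.
case: N => [|N] /=; last by case/allpairsPdep => p [z' [_ _ ->]].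
by case: eqP => // _; rewrite inE => /eqP->.
Qed.

Lemma size_strip b mu s : s \in strips b (rcons mu 0%N) -> size s = (size mu).+1.
Proof. by move=> /stripsP[-> _]; rewrite size_rcons. Qed.

Lemma patterns_uniq b N mu la : uniq (patterns b N mu la).
Proof.
elim: N mu => [|N IH] mu /=; first by case: ifP.
apply: allpairs_uniq_dep => [||]; [exact: row_pairs_uniq | by move=> p _; apply: IH |].
move=> _ _ /allpairsPdep[[[s h] nu] [z [/row_pairsP[sP hP nuP] zP ->]]]
  /allpairsPdep[[[s' h'] nu'] [z' [/row_pairsP[s'P h'P nu'P] z'P ->]]] /= [e ez].
have [es eh] := half_row_inj (size_strip sP) (size_strip s'P) e.
(* The row [nu] is not listed separately in the pattern; it is the head of the tail. *)
have enu : nu = nu' by apply: qrow_inj; rewrite -(patterns_head zP) -(patterns_head z'P) ez.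
by rewrite ez es eh enu.
Qed.

(** First entries increase weakly from each row to the next, so any bound above the first entry of
    [la] captures all patterns. *)
Lemma so_pattern_head l N mu la z : (0 < l)%N -> size mu = l -> sorted geq mu ->
  so_pattern l N mu la z -> (nth 0 mu 0 <= nth 0 la 0)%N.
Proof.
elim: N l mu z => [|N IH] l mu z l0 sz mu_sorted.
  by move=> /(so_pattern0 _ _ sz mu_sorted)[_ ->].
case/(so_patternS _ _ _ l0 sz mu_sorted) => r [nu [z' [_ sznu nusorted rs zP]]].
apply: leq_trans (IH _ _ _ _ sznu nusorted zP) => //.
rewrite -(ler_nat rat).
have /andP[_ le1] := step_below rs l0; have /andP[_ le2] := step_above rs l0.
exact: le_trans le2.
Qed.

Lemma mem_patterns l b N mu la z : (0 < l)%N -> size mu = l -> sorted geq mu ->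
  (nth 0 la 0 < b)%N -> z \in patterns b N mu la <-> so_pattern l N mu la z.
Proof.
move=> + + + lab; elim: N l mu z => [|N IH] l mu z l0 sz mu_sorted.
  split=> [/=|/(so_pattern0 _ _ sz mu_sorted)[-> <-]]; last by rewrite /= eqxx inE.
  by case: eqP => // <-; rewrite inE => /eqP->; apply/so_pattern0.
split=> [/allpairsPdep[[[s h] nu] [z' [/row_pairsP[sP hP nuP] z'P ->]]]|].
  have szs := size_strip sP; have [sznu _] := (stripsP _ _ _).1 nuP.
  have nusorted := strips_sorted nuP.
  apply/(so_patternS _ _ _ l0 sz mu_sorted); exists (half_row s h), nu, z'; split=> //.
  - by rewrite sznu szs sz.
  - exact: row_step_half_row sP hP nuP.
  - by apply/IH => //; rewrite sznu szs sz.
case/(so_patternS _ _ _ l0 sz mu_sorted) => r [nu [z' [-> sznu nusorted rs zP]]].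
have nub : (nth 0 nu 0 < b)%N by apply: leq_ltn_trans lab; apply: so_pattern_head zP.
have [s [h [sP hP -> nuP]]] := half_row_row_step l0 sz sznu nub rs.
apply/allpairsPdep; exists (s, h, nu), z'; split=> //; first by apply/row_pairsP.
by apply/(IH l.+1).
Qed.

Lemma sum_qrow s : \sum_(t <- qrow s) t = (sumn s)%:R.
Proof. by rewrite big_map sumnE natr_sum. Qed.

Lemma sum_half_row l s h : size s = l.+1 ->
  \sum_(t <- half_row s h) t = (sumn s)%:R - h%:R / 2.
Proof.
move=> sz; rewrite big_map sz -[iota 0 _]/(index_iota 0 l.+1) big_mkord sumrB.
congr (_ - _); first by rewrite sumnE (big_nth 0%N) sz big_mkord natr_sum.
rewrite big_ord_recr /= eqxx andbT big1 ?add0r // => j _.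
by rewrite eqSS (ltn_eqF (ltn_ord j)) andbF mul0r.
Qed.

Lemma zexp_cons0 b N mu nu la s h z : size s = (size mu).+1 -> z \in patterns b N nu la ->
  zexp [:: qrow mu, half_row s h & z] 0 =
  (sumn s).*2%:Z - h%:Z - (sumn nu)%:Z - (sumn mu)%:Z.
Proof.
move=> sz zP; rewrite /zexp /zexp_rat; set Z := [:: _, _ & _].
have -> : zsum Z 0.*2.+2 = (sumn nu)%:R.
  by rewrite -[LHS]/(zsum z 0) /zsum (patterns_head zP) sum_qrow.
have -> : zsum Z 0.*2.+1 = (sumn s)%:R - h%:R / 2 by apply: sum_half_row sz.
have -> : zsum Z 0.*2 = (sumn mu)%:R by apply: sum_qrow.
rewrite [X in Num.floor X](_ : _ = ((sumn s).*2%:Z - h%:Z - (sumn nu)%:Z - (sumn mu)%:Z)%:~R).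
  exact: intrKfloor.
rewrite !rmorphB /= -!pmulrn -mul2n natrM mulrBr [2 * (_ / _)]mulrC divfK //.
Qed.

Variable F : fieldType.

Lemma weight_rcons (L : seq (nat * (nat -> F))) l s c : size s = size L ->
  weight (rcons L l) (rcons s c) = weight L s * l.2 c.
Proof.
elim: L s => [|l' L IH] [|a s] //=; first by rewrite mul1r mulr1.
by move=> [sz]; rewrite IH // mulrA.
Qed.

(** With c the last entry of [s] and kappa the others, the exponent is (|kappa| - |mu|) + (c - h) +
    (|s| - |nu|); the two terms of [boundary_weight] at c are h = 0 and h = 1. *)
Lemma weight_half_rows (y : F) b mu s nu : y != 0 ->
  s \in strips b (rcons mu 0%N) -> nu \in strips b s ->
  weight (half_letters y mu) s * weight (power_letters y^-1 s) nu =
  \sum_(h <- halves s) y ^ ((sumn s).*2%:Z - (h : nat)%:Z - (sumn nu)%:Z - (sumn mu)%:Z).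
Proof.
move=> y0 sP nuP; have sz := size_strip sP.
have := weight_power_letters y^-1 nuP; set W' := weight _ nu => W'E.
have {}W'E : W' = y ^ ((sumn s)%:Z - (sumn nu)%:Z).
  apply: (mulIf (x := y^-1 ^+ sumn s)); first by rewrite expf_neq0 ?invr_eq0.
  rewrite W'E !exprVn !exprnN -expfzDr //; congr (_ ^ _); lia.
case/lastP: s sP sz {nuP} W' W'E => [//|kappa c] sP sz W' ->.
rewrite size_rcons in sz; case: sz => sz.
have kP : kappa \in strips b mu.
  have [_ H] := (stripsP _ _ _).1 sP; apply/stripsP; split=> // j jm.
  have := H j; rewrite size_rcons !nth_rcons sz jm ltnS (ltnW jm) => /(_ isT)[h1 h2]; split=> //.
  by case: j jm h1 h2 => // j jm _; rewrite nth_rcons (ltnW jm).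
have := weight_power_letters y kP; set W := weight _ kappa => WE.
have {}WE : W = y ^ ((sumn kappa)%:Z - (sumn mu)%:Z).
  apply: (mulIf (x := y ^+ sumn mu)); first by rewrite expf_neq0.
  by rewrite WE -[y ^+ sumn mu]/(y ^ (sumn mu)%:Z) -expfzDr // subrK.
rewrite /half_letters weight_rcons ?size_map // -/W WE /= /halves last_rcons.
have -> : sumn (rcons kappa c) = (sumn kappa + c)%N by rewrite sumn_rcons.
rewrite /boundary_weight; case: c {sP} => [|c] /=.
  rewrite big_seq1 mul0r addr0 expr0 mulr1 -expfzDr //; congr (_ ^ _); lia.
rewrite big_cons big_seq1 mul1r mulrDr mulrDl.
rewrite -[y ^+ c.+1]/(y ^ c.+1%:Z) -[y ^+ c]/(y ^ c%:Z) -!expfzDr //.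
by congr (_ ^ _ + _ ^ _); lia.
Qed.

Lemma sum_patternsS b N mu la (x : 'I_N.+1 -> F) : x ord0 != 0 ->
  \sum_(z <- patterns b N.+1 mu la) \prod_(i < N.+1) x i ^ zexp z i =
  \sum_(s <- strips b (rcons mu 0%N)) weight (half_letters (x ord0) mu) s *
    \sum_(nu <- strips b s) weight (power_letters (x ord0)^-1 s) nu *
      \sum_(z <- patterns b N nu la) \prod_(i < N) x (lift ord0 i) ^ zexp z i.
Proof.
move=> x0; rewrite /= /row_pairs !big_allpairs_dep /=; apply: eq_big_seq => s sP.
rewrite exchange_big /= mulr_sumr; apply: eq_big_seq => nu nuP.
rewrite mulrA (weight_half_rows x0 sP nuP) mulr_suml; apply: eq_bigr => h _.
rewrite mulr_sumr; apply: eq_big_seq => z zP.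
by rewrite big_ord_recl /= (zexp_cons0 h (size_strip sP) zP).
Qed.

Lemma skew_so_pattern_sum (pchar0 : [pchar F] =i pred0) l N mu la (x : 'I_N -> F) :
  (0 < l)%N -> size mu = l -> sorted geq mu -> size la = (l + N)%N -> sorted geq la ->
  (forall i, x i != 0) ->
  skew_so mu la x = \sum_(z \in [set z | so_pattern l N mu la z]) \prod_(i < N) x i ^ zexp z i.
Proof.
have patternsE N' l' mu' (x' : 'I_N' -> F) b : (0 < l')%N -> size mu' = l' -> sorted geq mu' ->
    (nth 0 la 0 < b)%N ->
    \sum_(z \in [set z | so_pattern l' N' mu' la z]) \prod_(i < N') x' i ^ zexp z i =
    \sum_(z <- patterns b N' mu' la) \prod_(i < N') x' i ^ zexp z i.
  move=> l0 sz mu_sorted lab; rewrite [RHS]fsbig_seq ?patterns_uniq //; apply: eq_fsbigl.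
  by apply/seteqP; split=> z /= /(mem_patterns _ _ l0 sz mu_sorted lab).
elim: N l mu x => [|N IH] l mu x l0 sz mu_sorted szla la_sorted x0.
  rewrite (patternsE _ _ _ _ (nth 0 la 0).+1) // skew_so0 ?sz ?szla ?addn0 //=.
  by case: eqP => _; rewrite ?big_nil // big_seq1 big_ord0.
have [B0 HB] := skew_soS pchar0 la mu_sorted (x0 ord0).
(* One bound for both purposes: the truncation in the branching formula and the enumeration of
   patterns. *)
pose b := maxn B0 (nth 0 la 0).+1.
have lab : (nth 0 la 0 < b)%N by rewrite leq_max ltnSn orbT.
rewrite (HB b) ?leq_maxl // (patternsE _ _ _ _ b) // sum_patternsS //.
apply: eq_big_seq => s sP; congr (_ * _); apply: eq_big_seq => nu nuP; congr (_ * _).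
have [sznu _] := (stripsP _ _ _).1 nuP; rewrite (size_strip sP) sz in sznu.
have nusorted := strips_sorted nuP.
rewrite (IH l.+1) //; last by rewrite szla addnS.
by rewrite (patternsE _ _ _ _ b).
Qed.

End PatternSum.

Theorem theorem3p5 (F : fieldType) (pchar0 : [pchar F] =i pred0)
    (l N : nat) (l_gt0 : (0 < l)%N) (N_gt0 : (0 < N)%N)
    (mu : l.-tuple nat) (lambda : (l + N).-tuple nat)
    (mu_part : sorted geq mu) (lambda_part : sorted geq lambda)
    (mu_sub_lambda : forall i, (i < l)%N -> (nth 0 mu i <= nth 0 lambda i)%N)
    (x : 'I_N -> F) (x_neq0 : forall i, x i != 0) :
  skew_so mu lambda x =
  \sum_(z \in [set z | so_pattern l N mu lambda z])
     \prod_(i < N) x i ^ zexp z i.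
Proof. by apply: skew_so_pattern_sum => //; rewrite size_tuple. Qed.
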